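(* Let $d\ge 1$ and let $\Phi(N,n)$ be complex weights ($N\ge 1$ integer, $n\in\mathbb Z$) such that for every $N$ the function $n\mapsto\Phi(N,n)$ has bounded support and $\sum_{n=-\infty}^{+\infty}\Phi(N,n)=1$. Assume the following. (i) There exist constants $K>0$ and $\vartheta>0$ such that for every integer $N\ge 1$ and every $t\in\mathbb R$, $$\left|\sum_{n=-\infty}^{+\infty}\Phi(N,n)e^{2\pi i n t}\right|\le K(1+N\|t\|)^{-\vartheta}.$$ (ii) The function $f$ is in the Sobolev class $W^{\delta,2}(\mathbb T^d)$, with $\delta>d/2$ if $0<\vartheta<1$, and $\delta>d\vartheta-d/2$ if $\vartheta\ge 1$. Then for almost every $\alpha$ (in $\mathbb R^d$, equivalently in $\mathbb T^d$) there exists a positive constant $c(f,\alpha)$ such that for every positive integer $N$, $$\sup_{x\in\mathbb T^d}\left|\mathcal D_N^{\Phi,\alpha}f(x)\right|\le c(f,\alpha)N^{-\vartheta}.$$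
   Context: $\mathbb T^d=\mathbb R^d/\mathbb Z^d$; functions on $\mathbb T^d$ are identified with $\mathbb Z^d$-periodic functions on $\mathbb R^d$. For real $t$, $\|t\|=\inf_{n\in\mathbb Z}|t-n|$. Fourier coefficients: $\widehat f(m)=\int_{\mathbb T^d}f(x)e^{-2\pi i m\cdot x}dx$, $m\in\mathbb Z^d$. For $\delta>0$, $W^{\delta,2}(\mathbb T^d)$ is the space of distributions on $\mathbb T^d$ with $\|f\|_{\delta,2}=\left(\sum_{m\in\mathbb Z^d}(1+|m|^2)^\delta|\widehat f(m)|^2\right)^{1/2}<\infty$; when $\delta>d/2$ its elements have absolutely convergent Fourier series and are identified with their continuous representatives. The weighted discrepancy is $$\mathcal D_N^{\Phi,\alpha}f(x)=\sum_{n=-\infty}^{+\infty}\Phi(N,n)f(x+n\alpha)-\int_{\mathbb T^d}f(y)\,dy .$$ *)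

(* Defs.v *)
From HB Require Import structures.
From mathcomp Require Import all_boot all_order all_algebra.
From mathcomp Require Import complex.
From mathcomp Require Import all_classical all_reals all_analysis.

Set Implicit Arguments.
Unset Strict Implicit.
Unset Printing Implicit Defensive.

Import Order.TTheory GRing.Theory Num.Theory.
Import numFieldNormedType.Exports.

Local Open Scope classical_set_scope.
Local Open Scope ring_scope.
Local Open Scope complex_scope.

Section measurable_rV.
Context {disp : measure_display} {T : sigmaRingType disp}.
Variable n : nat.

Let coord : 'I_n -> 'rV[T]_n -> T := fun i x => x ord0 i.

Let rV_set0 : g_sigma_preimage coord set0.
Proof. exact: sigma_algebra0. Qed.

Let rV_setC A : g_sigma_preimage coord A -> g_sigma_preimage coord (~` A).
Proof. exact: sigma_algebraC. Qed.

Let rV_bigcup (F : _^nat) : (forall i, g_sigma_preimage coord (F i)) ->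
  g_sigma_preimage coord (\bigcup_i (F i)).
Proof. exact: sigma_algebra_bigcup. Qed.

(* The product sigma-algebra on row vectors, as for [n.-tuple T]; it is the
   Borel sigma-algebra of R^n when T is R. *)
HB.instance Definition _ := @isMeasurable.Build (measure_tuple_display disp)
  'rV[T]_n (g_sigma_preimage coord) rV_set0 rV_setC rV_bigcup.

End measurable_rV.

Lemma measurable_coord_rV (disp : measure_display) (T : sigmaRingType disp)
    (n : nat) (i : 'I_n) :
  measurable_fun [set: 'rV[T]_n] (fun x => x ord0 i).
Proof.
move=> _ Y mY; rewrite setTI; apply: sub_sigma_algebra => /=.
rewrite -bigcup_seq/=; exists i => /=; first by rewrite mem_index_enum.
by exists Y => //; rewrite setTI.
Qed.

Lemma measurable_fun_rV (d1 d2 : measure_display) (T1 : measurableType d1)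
    (T2 : measurableType d2) (n : nat) (f : T1 -> 'rV[T2]_n) :
  (forall i, measurable_fun [set: T1] (fun t => f t ord0 i)) ->
  measurable_fun [set: T1] f.
Proof.
move=> mf _ A mA; rewrite setTI.
suff : g_sigma_preimage (fun i t => f t ord0 i) `<=` @measurable _ T1.
  apply; rewrite (g_sigma_preimage_comp (fun i (x : 'rV[T2]_n) => x ord0 i) f).
  by exists A => //; rewrite setTI.
apply: smallest_sub; first exact: sigma_algebra_measurable.
case: n => [|n] in f mf A mA *; first by rewrite big_ord0.
rewrite -bigcup_mkord_ord; apply: bigcup_sub => i Ii.
by move=> B [C mC <-]; exact: mf.
Qed.

Section lebesgue_rV.
Variable R : realType.

Definition cons_rV n (p : measurableTypeR R * 'rV[R]_n) : 'rV[R]_n.+1 :=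
  \row_i (if unlift ord0 i is Some j then p.2 ord0 j else p.1).

Definition uncons_rV n (v : 'rV[R]_n.+1) : measurableTypeR R * 'rV[R]_n :=
  (v ord0 ord0, \row_j v ord0 (lift ord0 j)).

Lemma cons_rVE0 n p : @cons_rV n p ord0 ord0 = p.1.
Proof. by rewrite mxE unlift_none. Qed.

Lemma cons_rVES n p (j : 'I_n) : cons_rV p ord0 (lift ord0 j) = p.2 ord0 j.
Proof. by rewrite mxE liftK. Qed.

Lemma cons_rVK n : cancel (@cons_rV n) (@uncons_rV n).
Proof.
move=> [a v]; rewrite /uncons_rV cons_rVE0; congr pair.
by apply/rowP => j; rewrite mxE cons_rVES.
Qed.

Lemma measurable_cons_rV n :
  measurable_fun [set: measurableTypeR R * 'rV[R]_n] (@cons_rV n).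
Proof.
apply: measurable_fun_rV => i; case: (unliftP ord0 i) => [j ->|->].
  under eq_fun do rewrite cons_rVES.
  exact: (measurableT_comp (measurable_coord_rV j) measurable_snd).
under eq_fun do rewrite cons_rVE0.
exact: measurable_fst.
Qed.

Lemma measurable_uncons_rV n : measurable_fun setT (@uncons_rV n).
Proof.
apply/measurable_fun_pair; first exact: (@measurable_coord_rV _ R).
apply: measurable_fun_rV => i; under eq_fun do rewrite mxE.
exact: measurable_coord_rV.
Qed.

Section step.
Variables (n : nat) (mu : {sigma_finite_measure set 'rV[R]_n -> \bar R}).

Definition lebesgue_rVS : set 'rV[R]_n.+1 -> \bar R :=
  pushforward (lebesgue_measure \x mu)%E (@cons_rV n).

Let measurable_preimage_cons A :
  measurable A -> measurable (@cons_rV n @^-1` A).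
Proof.
by move=> mA; rewrite -[X in measurable X]setTI; exact: measurable_cons_rV.
Qed.

Let lebesgue_rVS0 : lebesgue_rVS set0 = 0%E.
Proof. by rewrite /lebesgue_rVS /pushforward preimage_set0 measure0. Qed.

Let lebesgue_rVS_ge0 A : (0 <= lebesgue_rVS A)%E.
Proof. exact: integral_ge0. Qed.

Let lebesgue_rVS_sigma_additive : semi_sigma_additive lebesgue_rVS.
Proof.
move=> F mF tF mUF; rewrite /lebesgue_rVS /pushforward preimage_bigcup.
apply: measure_semi_sigma_additive.
- by move=> k; exact: measurable_preimage_cons.
- apply/trivIsetP => i j _ _ ij; rewrite -preimage_setI.
  by move/trivIsetP : tF => /(_ _ _ _ _ ij) ->//; rewrite preimage_set0.
- by rewrite -preimage_bigcup; exact: measurable_preimage_cons.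
Qed.

HB.instance Definition _ := isMeasure.Build _ _ _ lebesgue_rVS
  lebesgue_rVS0 lebesgue_rVS_ge0 lebesgue_rVS_sigma_additive.

Let lebesgue_rVS_sigma_finite : sigma_finite setT lebesgue_rVS.
Proof.
have /sigma_finiteP[F [TF ndF Foo]] := sigma_finiteT (@lebesgue_measure R).
have /sigma_finiteP[G [TG ndG Goo]] := sigma_finiteT mu.
exists (fun k => @uncons_rV n @^-1` (F k `*` G k)).
  rewrite -preimage_bigcup -[LHS](preimage_setT (@uncons_rV n)); congr preimage.
  rewrite -setXTT TF TG predeqE => -[x y]; split=> /= [[[i _ Fix] [j _ Gjy]]|].
    exists (maxn i j) => //; split.
    - by move: x Fix; exact/subsetPset/ndF/leq_maxl.
    - by move: y Gjy; exact/subsetPset/ndG/leq_maxr.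
  by move=> [k _ [? ?]]; split; exists k.
move=> k; have [mFk Fkoo] := Foo k; have [mGk Gkoo] := Goo k; split.
  rewrite -[X in measurable X]setTI; apply: measurable_uncons_rV => //.
  exact: measurableX.
rewrite /lebesgue_rVS /pushforward -comp_preimage.
rewrite (_ : _ \o _ = id); last by apply/funext => x /=; rewrite cons_rVK.
by rewrite preimage_id product_measure1E// lte_mul_pinfty// ge0_fin_numE.
Qed.

HB.instance Definition _ := @Measure_isSigmaFinite.Build _ _ _
  lebesgue_rVS lebesgue_rVS_sigma_finite.

End step.

(* Lebesgue measure on R^n: the n-fold product of [lebesgue_measure]. *)
Fixpoint lebesgue_rV (n : nat) : {sigma_finite_measure set 'rV[R]_n -> \bar R} :=
  match n with
  | 0 => \d_(0 : 'rV[R]_0)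
  | n'.+1 => lebesgue_rVS (lebesgue_rV n')
  end.

End lebesgue_rV.

Lemma lebesgue_rV_box (R : realType) (n : nat) (A : 'I_n -> set R) :
  (forall i, measurable (A i)) ->
  lebesgue_rV R n [set x | forall i, A i (x ord0 i)]
  = (\prod_(i < n) lebesgue_measure (A i))%E.
Proof.
elim: n A => [|n IH] A mA.
  by rewrite big_ord0 /= diracE mem_set// => -[].
rewrite big_ord_recl -IH; last by move=> i; exact: mA.
rewrite -product_measure1E; first last.
- rewrite [X in measurable X](_ : _ = \bigcap_(i in [set: 'I_n])
      ((fun x : 'rV[R]_n => x ord0 i) @^-1` A (lift ord0 i))).
    by apply: fin_bigcap_measurable => // i _;
      rewrite -[X in measurable X]setTI; exact: measurable_coord_rV.
  by apply/seteqP; split => x /= h i; [move=> _|]; exact: h.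
- exact: mA.
rewrite /= /lebesgue_rVS /pushforward; congr (_ _).
apply/seteqP; split => -[a v] /= h.
  split; first by have := h ord0; rewrite cons_rVE0.
  by move=> i; have := h (lift ord0 i); rewrite cons_rVES.
move=> i; case: (unliftP ord0 i) => [j ->|->].
  by rewrite cons_rVES; exact: h.2.
by rewrite cons_rVE0; exact: h.1.
Qed.

Section torus.
Variables (R : realType) (d : nat).

(* exp(2 pi i t) *)
Definition e2pi (t : R) : R[i] := cos (2 * pi * t) +i* sin (2 * pi * t).

Definition dist_int (t : R) : R := inf [set `|t - n%:~R| | n in [set: int]].

Definition dot_int (m : 'rV[int]_d) (x : 'rV[R]_d) : R :=
  \sum_(i < d) (m ord0 i)%:~R * x ord0 i.

Definition sqnorm_int (m : 'rV[int]_d) : R := \sum_(i < d) (m ord0 i)%:~R ^+ 2.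

Definition periodic_Zd (f : 'rV[R]_d -> R[i]) : Prop :=
  forall (x : 'rV[R]_d) (m : 'rV[int]_d), f (x + map_mx intr m) = f x.

(* A fundamental domain of R^d / Z^d *)
Definition unit_cube : set 'rV[R]_d :=
  [set x | forall i, 0 <= x ord0 i < 1].

Definition torus_int (f : 'rV[R]_d -> R[i]) : R[i] :=
  (\int[lebesgue_rV R d]_(x in unit_cube) complex.Re (f x))
  +i* (\int[lebesgue_rV R d]_(x in unit_cube) complex.Im (f x)).

Definition fourier_coef (f : 'rV[R]_d -> R[i]) (m : 'rV[int]_d) : R[i] :=
  torus_int (fun x => f x * e2pi (- dot_int m x)).

Definition sobolev_norm (delta : R) (f : 'rV[R]_d -> R[i]) : \bar R :=
  ((\esum_(m in [set: 'rV[int]_d])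
     ((1 + sqnorm_int m) `^ delta
      * ComplexField.Normc.normc (fourier_coef f m) ^+ 2)%:E) `^ 2^-1)%E.

(* Membership in W^{delta,2}(T^d), for delta > d/2 only: in that range the
   elements of the space are identified with their continuous representatives.
   The annotation selects the topology of R[i] given by its modulus. *)
Definition sobolev (delta : R) (f : 'rV[R]_d -> R[i]) : Prop :=
  [/\ continuous (f : 'rV[R]_d -> (R[i] : numFieldType)),
      periodic_Zd f &
      (sobolev_norm delta f < +oo)%E].

Definition bounded_support (w : int -> R[i]) : Prop :=
  exists M : nat, forall n : int, (M < `|n|)%N -> w n = 0.

(* The sums over [set: int] are finitary ([fsbigop]): they are meant for
   weights [Phi N] of bounded support. *)
Definition discrepancy (Phi : nat -> int -> R[i]) (N : nat) (alpha : 'rV[R]_d)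
    (f : 'rV[R]_d -> R[i]) (x : 'rV[R]_d) : R[i] :=
  (\sum_(n \in [set: int]) Phi N n * f (x + alpha *~ n)) - torus_int f.

End torus.

(* Main.v *)
(* Write a_m for |f^(m)|. The Fourier series of f gives
     sup_x |D_N f(x)| <= sum_{m <> 0} a_m |sum_n Phi(N,n) e(n m.alpha)|
                      <= K N^(-theta) sum_{m <> 0} a_m ||m.alpha||^(-theta),
   so it suffices that the last series converges for almost every alpha. Choose
   0 < q <= 1 with theta q < 1 and delta > d/q - d/2. By Hoelder's inequality the
   sum of a_m^q is finite, and the integral of ||m.alpha||^(-theta q) over a cube is
   bounded independently of m <> 0, hence sum_m (a_m ||m.alpha||^(-theta))^q is
   finite almost everywhere; since q <= 1 so is sum_m a_m ||m.alpha||^(-theta).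
   The integral is handled dyadically: it is dominated by a sum over j of 2^(j theta q)
   times the measure of {||m.alpha|| < 2^-j}, so only these measures are computed.
   The first inequality is proved for Fejer means, where the discrepancy is a
   finite sum over frequencies, and transferred to f by pointwise convergence
   at the finitely many points x + n alpha; translation invariance of the integral is
   never needed. *)
Require Import Defs.
From mathcomp Require Import all_boot all_order all_algebra.
From mathcomp Require Import complex.
From mathcomp Require Import all_classical all_reals all_analysis.
From mathcomp Require Import measurable_realfun ring lra.
Import Order.TTheory GRing.Theory Num.Theory.
Import numFieldNormedType.Exports.
Local Open Scope classical_set_scope.
Local Open Scope ring_scope.
Local Open Scope complex_scope.

Set Implicit Arguments.
Unset Strict Implicit.
Unset Printing Implicit Defensive.

(** * Sums bounded uniformly over finite lists *)

Section bounded_sums.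
Context {R : realType}.

(** For nonnegative [a] this is summability. Quantifying over duplicate-free lists makes it
    independent of any enumeration of [I], which suits sums over ['rV[int]_d]. *)
Definition bounded_sums (I : eqType) (a : I -> R) :=
  exists C : R, forall s : seq I, uniq s -> \sum_(i <- s) a i <= C.

Lemma ler_sum_uniq (I : eqType) (a : I -> R) (s t : seq I) :
  (forall i, 0 <= a i) -> uniq s -> uniq t -> {subset s <= t} ->
  \sum_(i <- s) a i <= \sum_(i <- t) a i.
Proof.
move=> a0 us ut st.
have tE : perm_eq t (s ++ [seq i <- t | i \notin s]); last first.
  rewrite (perm_big _ tE).
  by rewrite big_cat/= lerDl sumr_ge0.
apply: uniq_perm => //.
  rewrite cat_uniq us filter_uniq// andbT; apply/hasPn => i.
  by rewrite mem_filter => /andP[].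
move=> i; rewrite mem_cat mem_filter; by case: (boolP (i \in s)) => //= /st.
Qed.

Lemma ler_powRN (s x y : R) : 0 <= s -> 0 < x -> x <= y ->
  y `^ (- s) <= x `^ (- s).
Proof.
move=> s0 x0 xy; have y0 := lt_le_trans x0 xy.
rewrite !powRN lef_pV2 ?posrE ?powR_gt0//.
by rewrite ge0_ler_powR// nnegrE ltW.
Qed.

Lemma bounded_sums_le (I : eqType) (a b : I -> R) :
  (forall i, a i <= b i) -> bounded_sums b -> bounded_sums a.
Proof.
move=> ab [C hC]; exists C => s us; apply: le_trans (hC s us).
by apply: ler_sum => i _.
Qed.

Lemma bounded_sumsD (I : eqType) (a b : I -> R) :
  bounded_sums a -> bounded_sums b -> bounded_sums (fun i => a i + b i).
Proof.
move=> [C hC] [D hD]; exists (C + D) => s us.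
by rewrite big_split/= lerD ?hC ?hD.
Qed.

Lemma bounded_sumsZ (I : eqType) (a : I -> R) (c : R) : 0 <= c ->
  bounded_sums a -> bounded_sums (fun i => c * a i).
Proof.
move=> c0 [C hC]; exists (c * C) => s us.
by rewrite -mulr_sumr ler_wpM2l ?hC.
Qed.

Lemma bounded_sums_inj (I J : eqType) (h : J -> I) (a : I -> R) :
  injective h -> bounded_sums a -> bounded_sums (a \o h).
Proof.
move=> hi [C hC]; exists C => s us.
by have := hC (map h s); rewrite map_inj_uniq// big_map; apply.
Qed.

(** A finite list of pairs lies in the rectangle spanned by its two projections, and over a
    rectangle the sum factors. *)
Lemma bounded_sumsM (I J : eqType) (a : I -> R) (b : J -> R) :
  (forall i, 0 <= a i) -> (forall j, 0 <= b j) ->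
  bounded_sums a -> bounded_sums b ->
  bounded_sums (fun p : I * J => a p.1 * b p.2).
Proof.
move=> a0 b0 [C hC] [D hD]; exists (C * D) => s us.
pose s1 := undup (map fst s); pose s2 := undup (map snd s).
have h : \sum_(p <- s) a p.1 * b p.2 <=
    \sum_(p <- [seq (i, j) | i <- s1, j <- s2]) a p.1 * b p.2.
  apply: ler_sum_uniq => //.
  - by move=> i; rewrite mulr_ge0.
  - by apply: allpairs_uniq; rewrite ?undup_uniq// => -[? ?] [? ?].
  - move=> [i j] ij; apply/allpairsP; exists (i, j); split => //=.
    + by rewrite mem_undup; apply/mapP; exists (i, j).
    + by rewrite mem_undup; apply/mapP; exists (i, j).
apply: le_trans h _.
rewrite big_allpairs/=.
under eq_bigr do rewrite -mulr_sumr.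
rewrite -mulr_suml ler_pM ?sumr_ge0 ?hC ?hD ?undup_uniq//.
Qed.

Lemma bounded_sums_fin (I : finType) (a : I -> R) :
  (forall i, 0 <= a i) -> bounded_sums a.
Proof.
move=> a0; exists (\sum_(i <- enum I) a i) => s us.
by apply: ler_sum_uniq => //; [exact: enum_uniq|move=> i; rewrite mem_enum].
Qed.

Lemma bounded_sums_telescope (a g : nat -> R) :
  (forall n, 0 <= a n) -> (forall n, 0 <= g n) ->
  (forall n, a n <= g n - g n.+1) -> bounded_sums a.
Proof.
move=> a0 g0 ag; exists (g 0%N) => s us.
pose m := (\max_(i <- s) i).+1.
have h : \sum_(i <- s) a i <= \sum_(i <- iota 0 m) a i.
  apply: ler_sum_uniq => //; first exact: iota_uniq.
  by move=> i si; rewrite mem_iota add0n/= ltnS leq_bigmax_seq.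
apply: le_trans h _; rewrite -[iota 0 m]/(index_iota 0 m).
apply: (@le_trans _ _ (\sum_(0 <= i < m) (g i - g i.+1))).
  by apply: ler_sum => i _.
by under eq_bigr do rewrite -opprB; rewrite sumrN telescope_sumr// opprB gerBl.
Qed.

Lemma bounded_sums_geometric (x : R) : 0 <= x < 1 ->
  bounded_sums (fun j => x ^+ j).
Proof.
move=> /andP[x0 x1]; have x1' : 0 < 1 - x by rewrite subr_gt0.
apply: (@bounded_sums_telescope _ (fun j => x ^+ j / (1 - x))) => n.
- by rewrite exprn_ge0.
- by apply: divr_ge0; [exact: exprn_ge0|exact: ltW].
- rewrite -mulrBl exprS -{2}[x ^+ n]mul1r -mulrBl mulrAC divff ?mul1r//.
  by rewrite gt_eqF.
Qed.

(* (1 - z)^(-u) >= 1 + u z with z = 1/(n+2), by [1 + x <= expR x] used twice *)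
Lemma riemann_telescope (u : R) (n : nat) : 0 < u ->
  (n.+2%:R : R) `^ (- (1 + u)) <= u^-1 * (n.+1%:R `^ (- u) - n.+2%:R `^ (- u)).
Proof.
move=> u0; rewrite mulrC ler_pdivlMr//.
set y : R := n.+2%:R; set x : R := n.+1%:R.
have y0 : 0 < y by rewrite ltr0n.
have x0 : 0 < x by rewrite ltr0n.
have yx : y = x + 1 by rewrite /y /x -[in LHS]natr1.
have -> : y `^ (- (1 + u)) = y^-1 * y `^ (- u).
  rewrite opprD powRD; last by rewrite (gt_eqF y0) implybT.
  by rewrite powR_inv1// ltW.
have h : (1 + u / y) * y `^ (- u) <= x `^ (- u).
  have -> : x = y * (1 - y^-1) by rewrite mulrBr mulr1 divff ?gt_eqF// yx addrK.
  have z0 : 0 < 1 - y^-1.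
    by rewrite subr_gt0 invf_lt1// yx ltrDr.
  rewrite (powRM _ (ltW y0) (ltW z0)) [leLHS]mulrC ler_pM2l ?powR_gt0//.
  rewrite [leRHS]/powR gt_eqF//.
  apply: le_trans (expR_ge1Dx _); rewrite lerD2l mulNr -mulrN ler_pM2l//.
  rewrite lerNr; have := le_ln1Dx (x := - y^-1); apply.
  by rewrite ltrN2 invf_lt1// yx ltrDr.
have -> : y^-1 * y `^ (- u) * u = (1 + u / y) * y `^ (- u) - y `^ (- u) by ring.
by rewrite lerD2r.
Qed.

Lemma bounded_sums_riemann (u : R) : 0 < u ->
  bounded_sums (fun n => n.+1%:R `^ (- (1 + u))).
Proof.
move=> u0.
(* The value [1 + u^-1] at [0] makes the first difference exactly [1], the term of index [0]; later
   differences are those of [riemann_telescope]. *)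
apply: (@bounded_sums_telescope _
  (fun n => if n is m.+1 then u^-1 * m.+1%:R `^ (- u) else 1 + u^-1)).
- by move=> n; exact: powR_ge0.
- have u1 : 0 <= u^-1 by rewrite invr_ge0 ltW.
  by case=> [|n]; rewrite ?addr_ge0// ?mulr_ge0 ?powR_ge0.
- case=> [|n]; first by rewrite !powR1 mulr1 addrK.
  by rewrite -mulrBr; exact: riemann_telescope.
Qed.

(** With [n] the absolute value of [k], [(n + 1)^2 <= 2 (1 + n^2)] compares the terms with a Riemann
    series of exponent [2 s = 1 + u]. *)
Lemma bounded_sums_int (s : R) : 2^-1 < s ->
  bounded_sums (fun k => (1 + k%:~R ^+ 2) `^ (- s)).
Proof.
move=> s2; pose u := 2 * s - 1; have u0 : 0 < u by rewrite /u; lra.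
(* Sign and absolute value embed [int] into [bool * nat], so each term of the Riemann series is used
   at most twice. *)
pose h (k : int) : bool * nat := ((0 <= k)%R, `|k|%N).
have hi : injective h by move=> [i|i] [j|j] //= -[->].
pose b (p : bool * nat) := 1 * (2 `^ s * p.2.+1%:R `^ (- (1 + u))) : R.
apply: (@bounded_sums_le _ _ (b \o h)); last first.
  apply: bounded_sums_inj => //.
  apply: (@bounded_sumsM _ _ (fun=> 1) (fun n => 2 `^ s * n.+1%:R `^ (- (1 + u)))) => //.
  - exact: bounded_sums_fin.
  - by apply: bounded_sumsZ; [exact: powR_ge0|exact: bounded_sums_riemann].
move=> k; rewrite /b/= mul1r.
set n := `|k|%N.
have -> : (k%:~R : R) ^+ 2 = n%:R ^+ 2.
  by rewrite /n natr_absz intr_norm real_normK// num_real.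
have -> : 1 + u = 2 * s by rewrite /u; ring.
have p1 : 0 < n.+1%:R :> R by rewrite ltr0n.
have p2 : 0 < 1 + (n%:R : R) ^+ 2 by rewrite ltr_pwDl ?sqr_ge0.
have -> : (n.+1%:R : R) `^ (- (2 * s)) = (n.+1%:R ^+ 2) `^ (- s).
  by rewrite -powR_mulrn// -powRrM mulrN.
have -> : 2 `^ s = 2^-1 `^ (- s) :> R.
  by rewrite -powR_inv1// -powRrM mulN1r opprK.
rewrite -powRM ?invr_ge0 ?exprn_ge0//; apply: ler_powRN.
- by lra.
- by rewrite mulr_gt0 ?invr_gt0 ?exprn_gt0.
- rewrite -(natr1 n); move: (n%:R) => x.
  rewrite -subr_ge0 (_ : _ - _ = 2^-1 * (x - 1) ^+ 2); last by field.
  by rewrite mulr_ge0 ?invr_ge0 ?sqr_ge0.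
Qed.

(** Each factor is at most [1 + \sum_i x i ^+ 2]. This reduces decay in the Euclidean norm to a
    product of one-dimensional decays. *)
Lemma ler1_sumn_sqr (d : nat) (x : 'I_d -> R) :
  \prod_(i < d) (1 + x i ^+ 2) <= (1 + \sum_(i < d) x i ^+ 2) ^+ d.
Proof.
rewrite -[X in _ ^+ X]card_ord -prodr_const; apply: ler_prod => i _.
rewrite addr_ge0 ?sqr_ge0//= lerD2l (bigD1 i)//= lerDl sumr_ge0// => j _.
exact: sqr_ge0.
Qed.

Lemma bounded_sums_prod (a : int -> R) (d : nat) :
  (forall k, 0 <= a k) -> bounded_sums a ->
  bounded_sums (fun m : 'rV[int]_d => \prod_(i < d) a (m ord0 i)).
Proof.
move=> a0 ba; elim: d => [|d IH].
  exists 1 => s us; apply: (@le_trans _ _ (\sum_(i <- [:: 0 : 'rV[int]_0]) 1)).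
    under eq_bigr do rewrite big_ord0.
    apply: ler_sum_uniq => //.
    by move=> i _; rewrite inE; apply/eqP; exact: thinmx0.
  by rewrite big_seq1.
pose h (m : 'rV[int]_d.+1) := (m ord0 ord0, \row_j m ord0 (lift ord0 j)).
have hi : injective h.
  move=> u v [h0 /rowP hS]; apply/rowP => i; case: (unliftP ord0 i) => [j|] ->//.
  by have := hS j; rewrite !mxE.
have := bounded_sums_inj hi (bounded_sumsM a0 _ ba IH).
move=> /(_ _)[|C hC]; first by move=> m; exact: prodr_ge0.
exists C => s us; apply: le_trans (hC s us); apply: ler_sum => m _.
by rewrite big_ord_recl /=; under [in leRHS]eq_bigr do rewrite mxE.
Qed.

Lemma powR_prod (I : finType) (F : I -> R) (s : R) : (forall i, 0 <= F i) ->
  (\prod_i F i) `^ s = \prod_i F i `^ s.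
Proof.
move=> F0; suff [] : 0 <= \prod_i F i /\ (\prod_i F i) `^ s = \prod_i F i `^ s by [].
elim/big_rec2 : _ => [|i x y _ [y0 <-]]; first by rewrite powR1.
by rewrite mulr_ge0// powRM.
Qed.

(** By [ler1_sumn_sqr] the terms are dominated by products of [(1 + m_i^2)^(-s/d)]; each
    one-dimensional series converges because [s/d > 1/2]. *)
Lemma bounded_sums_sqnorm (d : nat) (s : R) : (0 < d)%N -> d%:R / 2 < s ->
  bounded_sums (fun m : 'rV[int]_d => (1 + sqnorm_int R m) `^ (- s)).
Proof.
move=> d0 ds; have dR : 0 < d%:R :> R by rewrite ltr0n.
have sd : 2^-1 < s / d%:R by rewrite ltr_pdivlMr// mulrC.
have := bounded_sums_prod d _ (bounded_sums_int sd).
move=> /(_ (fun _ => powR_ge0 _ _)); apply: bounded_sums_le => m.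
have p0 (i : 'I_d) : 0 < 1 + (m ord0 i)%:~R ^+ 2 :> R.
  by rewrite ltr_pwDl ?sqr_ge0.
have q0 : 0 < 1 + sqnorm_int R m.
  by rewrite ltr_pwDl// sumr_ge0// => i _; exact: sqr_ge0.
rewrite -powR_prod; last by move=> i; exact: ltW.
have -> : (1 + sqnorm_int R m) `^ (- s) =
    ((1 + sqnorm_int R m) ^+ d) `^ (- (s / d%:R)).
  rewrite -powR_mulrn ?(ltW q0)// -powRrM mulrN mulrCA divff ?gt_eqF//.
  by rewrite mulr1.
apply: ler_powRN; first by apply: ltW; apply: lt_trans sd; rewrite invr_gt0.
  by apply: prodr_gt0.
exact: ler1_sumn_sqr.
Qed.
End bounded_sums.

(** * Fourier coefficients of Sobolev functions *)

Section sobolev.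
Context {R : realType}.

Lemma bounded_sums_esum (I : choiceType) (a : I -> R) :
  (forall i, 0 <= a i) -> (\esum_(i in [set: I]) (a i)%:E < +oo)%E ->
  bounded_sums a.
Proof.
move=> a0 h; exists (fine (\esum_(i in [set: I]) (a i)%:E)%E) => s us.
rewrite -lee_fin fineK; last first.
  by rewrite ge0_fin_numE// esum_ge0// => i _; rewrite lee_fin.
rewrite -sumEFin; apply: ereal_sup_ubound; exists [set` s].
  by split=> //; exact: finite_seq.
by rewrite -fsbig_seq.
Qed.

(* The exponent of the last term is the one for which the two terms can balance. *)
Lemma powR_young (T a delta q : R) : 0 < T -> 0 <= a -> 0 < q < 2 ->
  a `^ q <= T `^ delta * a ^+ 2 + T `^ (- (delta * q / (2 - q))).
Proof.
move=> T0 a0 /andP[q0 q2]; set s := delta * q / (2 - q).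
have q2' : 0 < 2 - q by rewrite subr_gt0.
have [->|an] := eqVneq a 0.
  by rewrite powR0 ?gt_eqF// addr_ge0 ?mulr_ge0 ?powR_ge0.
have ap : 0 < a by rewrite lt_neqAle eq_sym an.
have a2 : 0 < a ^+ 2 by rewrite exprn_gt0.
have sq : a `^ q = (a ^+ 2) `^ (q / 2).
  by rewrite -powR_mulrn// -powRrM mulrC divfK.
(* At [a ^+ 2 = W] both terms on the right equal [T^(-s)]. Below this threshold the second term
   dominates [a^q], above it the first does. *)
pose W := T `^ (- (s + delta)).
have W0 : 0 < W by rewrite powR_gt0.
have [h|h] := leP (a ^+ 2) W.
  apply: (@le_trans _ _ (T `^ (- s))); last first.
    by rewrite lerDr mulr_ge0 ?powR_ge0 ?sqr_ge0.
  rewrite sq; apply: (@le_trans _ _ (W `^ (q / 2))).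
    by rewrite ge0_ler_powR ?nnegrE ?divr_ge0 ?(ltW q0) ?(ltW a2) ?(ltW W0).
  rewrite -powRrM (_ : - (s + delta) * (q / 2) = - s)// /s.
  by field; rewrite gt_eqF.
apply: (@le_trans _ _ (T `^ delta * a ^+ 2)); last by rewrite lerDl powR_ge0.
have -> : a `^ q = (a ^+ 2) `^ (- ((2 - q) / 2)) * a ^+ 2.
  rewrite sq -{3}[a ^+ 2](powRr1 (ltW a2)) -powRD ?(gt_eqF a2) ?implybT//.
  by congr powR; field.
rewrite ler_pM2r//.
have -> : T `^ delta = W `^ (- ((2 - q) / 2)).
  rewrite -powRrM; congr powR; rewrite /s.
  by field; rewrite gt_eqF.
by apply: ler_powRN => //; [rewrite divr_ge0 ?ltW|exact: ltW].
Qed.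

Lemma normc_ge0 (z : R[i]) : 0 <= ComplexField.Normc.normc z.
Proof. by case: z => x y; exact: sqrtr_ge0. Qed.

Lemma sqnorm_int_ge0 (d : nat) (m : 'rV[int]_d) : 0 <= sqnorm_int R m.
Proof. by apply: sumr_ge0 => i _; exact: sqr_ge0. Qed.

(** [powR_young] with [T = 1 + |m|^2] stands in for the Hoelder inequality: the first terms sum to
    the squared Sobolev norm, and the second ones converge since [delta q / (2 - q) > d/2] is the
    condition on [delta]. *)
Lemma bounded_sums_fourier (d : nat) (f : 'rV[R]_d -> R[i]) (delta q : R) :
  (0 < d)%N -> 0 < q < 2 -> d%:R / q - d%:R / 2 < delta ->
  (sobolev_norm delta f < +oo)%E ->
  bounded_sums (fun m => ComplexField.Normc.normc (fourier_coef f m) `^ q).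
Proof.
move=> d0 q02 hdelta hf; have /andP[q0 q2] := q02.
have q2' : 0 < 2 - q by rewrite subr_gt0.
apply: (@bounded_sums_le _ _ _ (fun m =>
    (1 + sqnorm_int R m) `^ delta
      * ComplexField.Normc.normc (fourier_coef f m) ^+ 2 +
    (1 + sqnorm_int R m) `^ (- (delta * q / (2 - q))))).
  move=> m; apply: powR_young => //; last exact: normc_ge0.
  by rewrite ltr_pwDl// sqnorm_int_ge0.
apply: bounded_sumsD.
  apply: bounded_sums_esum.
    by move=> m; rewrite mulr_ge0 ?powR_ge0 ?sqr_ge0.
  move: hf; rewrite /sobolev_norm; case: esum => [r _||] //; first exact: ltry.
  by rewrite poweRyr ?invr_eq0 ?pnatr_eq0.
apply: bounded_sums_sqnorm => //.
rewrite ltr_pdivlMr// -ltr_pdivrMr//.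
by apply: le_lt_trans hdelta; rewrite le_eqVlt; apply/orP; left;
  apply/eqP; field; rewrite gt_eqF.
Qed.

(** For [theta < 1] take [q = 1]. Otherwise [1/q] must lie strictly between [theta] and
    [e = (delta + D/2) / D]; their midpoint is chosen, and it exceeds [1]. *)
Lemma ex_summability_exponent (D theta delta : R) : 0 < D -> 0 < theta ->
  (theta < 1 -> D / 2 < delta) -> (1 <= theta -> D * theta - D / 2 < delta) ->
  exists q, [/\ 0 < q <= 1, theta * q < 1 & D / q - D / 2 < delta].
Proof.
move=> D0 t0 h1 h2; have [t1|t1] := ltP theta 1.
  exists 1; rewrite ltr01 lexx mulr1 divr1; split => //.
  by have := h1 t1; lra.
have {h2} {}h2 := h2 t1.
pose e := (delta + D / 2) / D.
have te : theta < e by rewrite /e ltr_pdivlMr//; lra.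
pose r := (theta + e) / 2.
have r0 : 0 < r by rewrite /r; lra.
exists r^-1; rewrite invr_gt0 r0/= invf_le1// ltr_pdivrMr// invrK; split.
- by rewrite /r; lra.
- by rewrite /r; lra.
- have : D * r < D * e by rewrite ltr_pM2l// /r; lra.
  by rewrite /e [D * (_ / D)]mulrC divfK ?gt_eqF//; lra.
Qed.

End sobolev.

(** * A weighted Borel-Cantelli lemma *)

Section borel_cantelli.
Context d (T : measurableType d) (R : realType).
Variable mu : {measure set T -> \bar R}.

(** Integrating the series term by term gives at most [C], so its sum is integrable and hence finite
    almost everywhere. *)
Lemma ae_bounded_sums (I : countType) (A : I -> set T) (w c : I -> R) :
  (forall i, measurable (A i)) -> (forall i, 0 <= w i) ->
  (forall i, (mu (A i) <= (c i)%:E)%E) ->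
  bounded_sums (fun i => w i * c i) ->
  {ae mu, forall x, bounded_sums (fun i => w i * \1_(A i) x)}.
Proof.
move=> mA w0 Ac [C hC].
(* The family is re-indexed by [nat] through [pickle_inv], with zero terms at codes that represent
   no index. *)
pose f k x : \bar R :=
  (if @pickle_inv I k is Some i then w i * \1_(A i) x else 0)%:E.
have f0 k x : (0 <= f k x)%E.
  by rewrite /f; case: (pickle_inv k) => // i; rewrite lee_fin mulr_ge0.
have mf k : measurable_fun setT (f k).
  rewrite /f; case: (pickle_inv k) => [i|]; last exact: measurable_cst.
  by apply/measurable_EFinP; apply: measurable_funM => //; exact: measurable_indic.
pose F x := (\sum_(k <oo) f k x)%E.
have intF : (\int[mu]_x F x <= C%:E)%E.
  rewrite integral_nneseries//; apply: lime_le.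
    by apply: is_cvg_nneseries => k _ _; exact: integral_ge0.
  apply: nearW => n.
  pose g k := if @pickle_inv I k is Some i then w i * c i else 0.
  apply: (@le_trans _ _ (\sum_(0 <= k < n) (g k)%:E)%E).
    apply: lee_sum => k _; rewrite /f /g; case: (pickle_inv k) => [i|].
      under eq_integral do rewrite EFinM.
      rewrite ge0_integralZl_EFin//; last first.
        by apply/measurable_EFinP; exact: measurable_indic.
      by rewrite integral_indic// setIT EFinM lee_wpmul2l// lee_fin.
    by rewrite integral0.
  rewrite sumEFin lee_fin.
  pose s := pmap (@pickle_inv I) (iota 0 n).
  have us : uniq s.
    by apply: (pmap_uniq (@pickle_invK I)); exact: iota_uniq.
  apply: le_trans (hC s us); rewrite le_eqVlt; apply/orP; left; apply/eqP.
  rewrite /s big_pmap /index_iota subn0; apply: eq_bigr => k _.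
  by rewrite /g; case: (pickle_inv k).
have mF : measurable_fun setT F.
  exact: ge0_emeasurable_sum.
have iF : mu.-integrable setT F.
  apply/integrableP; split => //.
  under eq_integral.
    move=> x _; rewrite gee0_abs; last exact: nneseries_ge0.
    over.
  by apply: le_lt_trans intF _; rewrite ltry.
have := integrable_ae measurableT iF; apply: filterS => x /(_ Logic.I) Fx.
exists (fine (F x)) => s us.
rewrite -lee_fin fineK// -sumEFin.
pose t := map (@pickle I) s.
have ut : uniq t by rewrite map_inj_uniq//; exact: (pcan_inj (@pickleK I)).
pose m := (\max_(k <- t) k).+1.
apply: le_trans (nneseries_lim_ge m (fun k _ _ => f0 k x)).
have -> : (\sum_(i <- s) (w i * \1_(A i) x)%:E = \sum_(k <- t) f k x)%E.
  by rewrite big_map; apply: eq_bigr => i _; rewrite /f pickleK_inv.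
have fE k : f k x = (fine (f k x))%:E by rewrite fineK.
under eq_bigr do rewrite fE; under [in leRHS]eq_bigr do rewrite fE.
rewrite !sumEFin lee_fin; apply: ler_sum_uniq => //.
- by move=> k; apply: fine_ge0.
- exact: iota_uniq.
- by move=> k tk; rewrite mem_index_iota/= ltnS leq_bigmax_seq.
Qed.

End borel_cantelli.

(** * Distance to the integers and one-dimensional resonances *)

Section near_int.
Context {R : realType}.

(** This describes [dist_int t < eps] without the infimum, as a countable union of balls, so
    measurability is immediate. *)
Definition near_int (eps : R) : set R :=
  [set t | exists n : int, `|t - n%:~R| < eps].

Lemma measurable_near_int (eps : R) : measurable (near_int eps).
Proof.
have -> : near_int eps = \bigcup_(n : int) ball (n%:~R : R) eps.
  apply/seteqP; split => t /=.
    by case=> n h; exists n => //; rewrite /ball/= distrC.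
  by case=> n _ h; exists n; rewrite distrC.
apply: countable_bigcupT_measurable; first exact: countableP.
by move=> n; exact: measurable_ball.
Qed.

Lemma dist_int_near_int (t eps : R) : dist_int t < eps -> near_int eps t.
Proof.
by move=> /inf_lt[|_ [n _ <-] h]; [exists `|t - 0%:~R|, 0|exists n].
Qed.

Lemma dist_int_ge0 (t : R) : 0 <= dist_int t.
Proof.
by apply: lb_le_inf; [exists `|t - 0%:~R|, 0|move=> x [n _ <-]].
Qed.

Lemma dist_int_lt1 (t : R) : dist_int t < 1.
Proof.
apply: (@le_lt_trans _ _ `|t - (Num.floor t)%:~R|).
  by apply: ge_inf; [exists 0 => x [n _ <-]|exists (Num.floor t)].
have /andP[h1 h2] := floor_itv t.
rewrite ger0_norm; rewrite ?subr_ge0//.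
by rewrite ltrBlDl -[1]/(1%:~R) -intrD.
Qed.

(* At most 2 |k| M + 3 integers n are within eps of [k a + b] for some [a]. *)
Lemma lebesgue_measure_near_int (A : set R) (k : int) (b : R) (M : nat)
    (eps : R) :
  measurable A -> k != 0 -> 0 < eps <= 1 ->
  (forall a, A a -> `|a| <= M%:R /\ near_int eps (k%:~R * a + b)) ->
  (lebesgue_measure A <= (((2 * M + 3)%N)%:R * (eps *+ 2))%:E)%E.
Proof.
move=> mA k0 /andP[e0 e1] hA.
pose q := `|k|%N.
have q0 : 0 < q%:R :> R by rewrite ltr0n absz_gt0.
have q1 : 1 <= q%:R :> R by rewrite ler1n absz_gt0.
have kq : `|k%:~R| = q%:R :> R by rewrite /q natr_absz intr_norm.
have kR : k%:~R != 0 :> R by rewrite intr_eq0.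
(* If [k a + b] is within [eps <= 1] of [n], then [n] differs from [b] by at most [q M + 1]; all
   such [n] are among the [L] integers starting at [n0]. The centre [c i] solves
   [k a + b = n0 + i]. *)
pose n0 := Num.floor (b - q%:R * M%:R - 1).
pose L := (2 * q * M + 3)%N.
pose c (i : nat) : R := ((n0 + i%:Z)%:~R - b) / k%:~R.
apply: (@le_trans _ _ (\sum_(i < L) lebesgue_measure (ball (c i) (eps / q%:R)))%E).
  apply: (@content_subadditive _ _ _ (@lebesgue_measure R) A
    (fun i => ball (c i) (eps / q%:R)) L) => //.
    by move=> i _; exact: measurable_ball.
  move=> a /hA[aM [n hn]].
  have kaM : `|k%:~R * a| <= q%:R * M%:R by rewrite normrM kq ler_pM2l.
  have /andP[h1 h2] := floor_itv (b - q%:R * M%:R - 1).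
  rewrite -/n0 in h1 h2.
  have n0n : n0 <= n.
    rewrite -ltzD1 -(ltr_int R) intrD.
    move: hn kaM; rewrite ltr_norml ler_norml => /andP[? ?] /andP[? ?]; lra.
  rewrite -(bigcup_mkord L (fun i => ball (c i) (eps / q%:R))); exists `|n - n0|%N => /=.
    rewrite -(ltr_nat R) natr_absz ger0_norm ?subr_ge0// intrB.
    rewrite /L natrD !natrM.
    move: h2; rewrite intrD.
    move: hn kaM; rewrite ltr_norml ler_norml => /andP[? ?] /andP[? ?] ?; lra.
  have -> : c `|n - n0|%N = (n%:~R - b) / k%:~R.
    by rewrite /c gez0_abs ?subr_ge0// [n0 + _]addrC subrK.
  rewrite /ball/= ltr_pdivlMr// -kq -normrM.
  by rewrite mulrBl mulfVK// distrC mulrC opprB addrA.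
under eq_bigr do rewrite lebesgue_measure_ball ?divr_ge0 ?(ltW e0) ?(ltW q0)//.
rewrite sumEFin lee_fin sumr_const card_ord.
have -> : eps / q%:R *+ 2 *+ L = L%:R / q%:R * (eps *+ 2).
  by rewrite -[LHS]mulr_natr -[in LHS]mulr_natr -[in RHS]mulr_natr; ring.
(* The number of intervals grows like [q] while their radius is [eps / q]; as [1 <= q], [L / q] is
   at most [2 M + 3], whatever [k] is. *)
rewrite ler_wpM2r ?mulrn_wge0 ?(ltW e0)// ler_pdivrMr// -natrM ler_nat.
rewrite /L mulnDl -mulnA [(q * M)%N]mulnC mulnA leq_add2l leq_pmulr//.
by rewrite absz_gt0.
Qed.

End near_int.

(** * Measure of neighbourhoods of resonant hyperplanes *)

Section strip.
Context {R : realType}.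

Lemma measurable_dot_int (n : nat) (m : 'rV[int]_n) :
  measurable_fun [set: 'rV[R]_n] (dot_int m : 'rV[R]_n -> R).
Proof.
apply: measurable_sum => i; apply: measurable_funM => //.
exact: (@measurable_coord_rV _ R).
Qed.

Lemma dot_int_cons (n : nat) (m : 'rV[int]_n.+1) (a : R) (v : 'rV[R]_n) :
  dot_int m (cons_rV (a, v)) =
  (m ord0 ord0)%:~R * a + dot_int (\row_j m ord0 (lift ord0 j)) v.
Proof.
rewrite /dot_int big_ord_recl cons_rVE0; congr +%R.
by apply: eq_bigr => i _; rewrite cons_rVES mxE.
Qed.

Definition cube (n : nat) (M : R) : set 'rV[R]_n :=
  [set x | forall i, `|x ord0 i| <= M].

Arguments cube : clear implicits.

(** The shift [b] serves induction on [n]: fixing the first coordinate of a point adds its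
    contribution to the shift. *)
Definition strip (n : nat) (m : 'rV[int]_n) (b M eps : R) : set 'rV[R]_n :=
  cube n M `&` [set x | near_int eps (dot_int m x + b)].

Lemma centered_itv (M : R) : [set x : R | `|x| <= M] = `[- M, M]%classic.
Proof. by apply/seteqP; split => a /=; rewrite in_itv/= ler_norml. Qed.

Lemma measurable_cube (n : nat) (M : R) : measurable (cube n M).
Proof.
rewrite (_ : cube n M = \bigcap_(i in [set: 'I_n])
    ((fun x : 'rV[R]_n => x ord0 i) @^-1` [set x | `|x| <= M])); last first.
  by apply/seteqP; split => [x h i _|x h i]; [exact: h|exact: (h i Logic.I)].
apply: fin_bigcap_measurable => // i _; rewrite -[X in measurable X]setTI.
by apply: (@measurable_coord_rV _ R) => //; rewrite centered_itv.
Qed.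

Lemma measurable_strip (n : nat) (m : 'rV[int]_n) (b M eps : R) :
  measurable (strip m b M eps).
Proof.
apply: measurableI; first exact: measurable_cube.
rewrite -[X in measurable X]setTI.
have mf : measurable_fun [set: 'rV[R]_n] (fun x => dot_int m x + b).
  by apply: measurable_funD => //; exact: measurable_dot_int.
by apply: mf => //; exact: measurable_near_int.
Qed.

Lemma lebesgue_centered_itv (M : R) : 0 <= M ->
  lebesgue_measure [set x : R | `|x| <= M] = (2 * M)%:E.
Proof.
move=> M0; rewrite centered_itv lebesgue_measure_itv/= lte_fin.
case: ltP => [_|h]; first by rewrite -EFinD opprK -mulr2n mulr_natl.
by congr EFin; lra.
Qed.

Lemma lebesgue_rV_cube (n : nat) (M : R) : 0 <= M ->
  lebesgue_rV R n (cube n M) = ((2 * M) ^+ n)%:E.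
Proof.
move=> M0; rewrite (lebesgue_rV_box (A := fun=> [set x | `|x| <= M])).
  under eq_bigr do rewrite lebesgue_centered_itv//.
  by rewrite prodEFin prodr_const card_ord.
by move=> _; rewrite centered_itv.
Qed.

(** Induction on the dimension, slicing along the first coordinate. If the remaining frequency [m']
    vanishes, the strip is a one-dimensional resonant set times a cube; otherwise each slice is a
    strip of lower dimension, bounded uniformly in its shift. The bound is the same for all
    [m != 0]. *)
Lemma lebesgue_rV_strip (n : nat) (m : 'rV[int]_n) (b : R) (M : nat) (eps : R) :
  m != 0 -> 0 < eps <= 1 ->
  (lebesgue_rV R n (strip m b M%:R eps) <=
   (((2 * M + 3)%N)%:R ^+ n * (eps *+ 2))%:E)%E.
Proof.
move=> + /andP[e0 e1].
elim: n m b => [|n IH] m b m0; first by rewrite thinmx0 eqxx in m0.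
pose m' : 'rV[int]_n := \row_j m ord0 (lift ord0 j).
pose L : R := (2 * M + 3)%N%:R.
have M0 : 0 <= M%:R :> R by [].
have ML : 2 * M%:R <= L by rewrite /L natrD natrM lerDl.
have L1 : 0 < L by rewrite ltr0n addn3.
set B := @cons_rV R n @^-1` strip m b M%:R eps.
have mB : measurable B.
  rewrite -[X in measurable X]setTI; apply: measurable_cons_rV => //.
  exact: measurable_strip.
have BE a v : B (a, v) <-> `|a| <= M%:R /\
    strip m' ((m ord0 ord0)%:~R * a + b) M%:R eps v.
  rewrite /B /strip/= dot_int_cons -/m'.
  rewrite [_ + dot_int m' v]addrC addrA.
  split=> [[h1 h2]|[h1 [h2 h3]]]; split => //.
  - by have := h1 ord0; rewrite cons_rVE0.
  - by split=> // i; have := h1 (lift ord0 i); rewrite cons_rVES.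
  - by move=> i; case: (unliftP ord0 i) => [j|] ->; rewrite ?cons_rVES ?cons_rVE0.
rewrite /= /lebesgue_rVS /pushforward -/B.
have [m'0|m'0] := eqVneq m' 0.
  have m00 : m ord0 ord0 != 0.
    apply: contra m0 => /eqP m00; apply/eqP/rowP => i; rewrite mxE.
    case: (unliftP ord0 i) => [j|] ->//.
    by move/rowP : m'0 => /(_ j); rewrite !mxE.
  pose A : set (measurableTypeR R) := [set a | `|a| <= M%:R] `&`
    [set a | near_int eps ((m ord0 ord0)%:~R * a + b)].
  have mA : measurable A.
    apply: measurableI; first by rewrite centered_itv; exact: measurable_itv.
    rewrite -[X in measurable X]setTI.
    have mf : measurable_fun [set: R] (fun x : R => (m ord0 ord0)%:~R * x + b).
      by apply: measurable_funD => //; apply: measurable_funM.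
    by apply: mf => //; exact: measurable_near_int.
  have -> : B = A `*` cube n M%:R.
    apply/seteqP; split => -[a v] /=; rewrite BE /strip/= m'0.
      have -> : dot_int 0 v = 0 by rewrite /dot_int big1// => i _; rewrite mxE mul0r.
      by rewrite add0r => -[? []].
    have -> : dot_int 0 v = 0 by rewrite /dot_int big1// => i _; rewrite mxE mul0r.
    by rewrite add0r => -[[]].
  rewrite product_measure1E//; last exact: measurable_cube.
  rewrite lebesgue_rV_cube//.
  apply: (@le_trans _ _ ((L * (eps *+ 2))%:E * (L ^+ n)%:E)%E); last first.
    by rewrite -EFinM lee_fin exprS mulrAC.
  apply: lee_pmul => //.
    by apply: (lebesgue_measure_near_int mA m00 (b := b)) => //; rewrite e0.
  by rewrite lee_fin lerXn2r// ?nnegrE ?mulr_ge0// ltW.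
pose D : set (measurableTypeR R) := [set a | `|a| <= M%:R].
have mD : measurable D by rewrite /D centered_itv; exact: measurable_itv.
(* Slices outside [D] are empty, and [D] has length [2 M <= L], which supplies the additional factor
   [L]. *)
apply: (@le_trans _ _ (\int[lebesgue_measure]_(a in D)
    (L ^+ n * (eps *+ 2))%:E)%E); last first.
  rewrite integral_cst//.
  rewrite [X in (_ * X)%E](lebesgue_centered_itv M0) -EFinM lee_fin exprS mulrC.
  rewrite -mulrA ler_wpM2r//.
  by rewrite mulr_ge0 ?exprn_ge0 ?mulrn_wge0 ?(ltW e0) ?(ltW L1).
rewrite [leRHS]integral_mkcond; apply: ge0_le_integral => //.
- exact: measurable_fun_xsection.
- exact/(measurable_restrictT _ _).1.
move=> a _ /=; rewrite /patch; case: ifPn => [|/negP ha].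
  rewrite inE/= => ha.
  rewrite (_ : xsection B a = strip m' ((m ord0 ord0)%:~R * a + b) M%:R eps).
    exact: IH.
  by apply/seteqP; split => v; rewrite /xsection/= inE BE => // -[].
rewrite (_ : xsection B a = set0) ?measure0//.
apply/seteqP; split => v //; rewrite /xsection/= inE BE => -[h _].
by apply: ha; rewrite inE.
Qed.

End strip.
Arguments cube {R} n M.

(** * Convergence of the small-divisor series *)

Section small_divisors.
Context {R : realType}.

(** Each [b i ^ q] is at most the bound [C] of the sums. Writing [b = (b^q)^((1-q)/q) b^q], with
    nonnegative exponent [(1-q)/q], gives [b <= C^((1-q)/q) b^q]. *)
Lemma bounded_sums_powR (I : eqType) (b : I -> R) (q : R) :
  (forall i, 0 <= b i) -> 0 < q <= 1 ->
  bounded_sums (fun i => b i `^ q) -> bounded_sums b.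
Proof.
move=> b0 /andP[q0 q1] hb; have [C hC] := hb.
apply: (@bounded_sums_le _ _ _ (fun i => C `^ ((1 - q) / q) * b i `^ q)); last first.
  by apply: bounded_sumsZ => //; exact: powR_ge0.
move=> i; have bC : b i `^ q <= C by have := hC [:: i] isT; rewrite big_seq1.
have bE : b i = (b i `^ q) `^ ((1 - q) / q) * b i `^ q.
  have [->|bi] := eqVneq (b i) 0; first by rewrite [_ `^ q]powR0 ?mulr0 ?gt_eqF.
  rewrite -powRrM [q * _]mulrC divfK ?gt_eqF// -powRD ?bi ?implybT//.
  by rewrite subrK powRr1.
rewrite {1}bE ler_wpM2r ?powR_ge0// ge0_ler_powR ?nnegrE ?powR_ge0//.
  by rewrite divr_ge0 ?subr_ge0// ltW.
by apply: le_trans bC; exact: powR_ge0.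
Qed.

Lemma ex_dyadic (t : R) : 0 < t -> t < 1 ->
  exists j : nat, 2^-1 ^+ j.+1 <= t /\ t < 2^-1 ^+ j.
Proof.
move=> t0 t1.
have ex : exists j, 2^-1 ^+ j.+1 <= t.
  exists (Num.truncn t^-1).
  rewrite exprVn invf_ple ?posrE ?exprn_gt0//.
  apply: ltW; apply: (lt_le_trans (truncnS_gt _)).
  by rewrite -natrX ler_nat ltnW// ltn_expl.
case: (ex_minnP ex) => j hj hmin; exists j; split => //.
case: j hj hmin => [|j] hj hmin; first by rewrite expr0.
by rewrite ltNge; apply/negP => /hmin; rewrite ltnn.
Qed.

Variables (d : nat) (a : 'rV[int]_d -> R) (theta q : R).
Hypotheses (a0 : forall m, 0 <= a m) (q01 : 0 < q <= 1).
Hypotheses (theta0 : 0 < theta) (thetaq : theta * q < 1).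
Hypothesis bounded_a : bounded_sums (fun m => a m `^ q).

Let p := theta * q.
(** [A M (m, j)] is where [m.x] is within [2^-j] of an integer. The weight [w (m, j)] dominates
    [(a m ||m.x||^(-theta))^q] as soon as [||m.x|| >= 2^-(j+1)], hence the exponent [j + 1]. *)
Let A (M : nat) (i : 'rV[int]_d * nat) : set 'rV[R]_d :=
  if i.1 == 0 then set0 else strip i.1 0 M%:R (2^-1 ^+ i.2).
Let w (i : 'rV[int]_d * nat) : R := a i.1 `^ q * (2 `^ p) ^+ i.2.+1.

(** The sets have measure [O(2^-j)] uniformly in [m], so the weighted series factors into the sum of
    [a m ^ q] and a geometric series of ratio [2^(p-1)], which is below [1] because
    [theta q < 1]. *)
Let ae_w (M : nat) :
  {ae lebesgue_rV R d, forall x, bounded_sums (fun i => w i * \1_(A M i) x)}.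
Proof.
pose L : R := (2 * M + 3)%N%:R ^+ d.
have q0 : 0 < q by case/andP: q01.
apply: (ae_bounded_sums (c := fun i => L * (2^-1 ^+ i.2 *+ 2))).
- by move=> [m j]; rewrite /A/=; case: ifP => // _; exact: measurable_strip.
- by move=> i; rewrite mulr_ge0 ?powR_ge0 ?exprn_ge0 ?powR_ge0.
- move=> [m j]; rewrite /A/=; case: ifPn => [_|m0].
    by rewrite measure0 lee_fin mulr_ge0 ?mulrn_wge0 ?exprn_ge0 ?invr_ge0.
  apply: lebesgue_rV_strip => //; rewrite exprn_gt0 ?invr_gt0//=.
  by rewrite exprn_ile1 ?invr_ge0 ?invf_le1 ?ler1n.
- pose b1 m := (L * 2 * 2 `^ p) * a m `^ q.
  pose b2 j : R := (2 `^ p * 2^-1) ^+ j.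
  apply: (@bounded_sums_le _ _ _ (fun i => b1 i.1 * b2 i.2)).
    move=> [m j]; rewrite /w /b1 /b2/= exprMn exprS -mulr_natr.
    by rewrite le_eqVlt; apply/orP; left; apply/eqP; ring.
  apply: bounded_sumsM.
  + move=> m; rewrite mulr_ge0 ?powR_ge0// mulr_ge0 ?powR_ge0// mulr_ge0//.
    by rewrite exprn_ge0.
  + by move=> j; rewrite exprn_ge0 ?mulr_ge0 ?powR_ge0 ?invr_ge0.
  + apply: bounded_sumsZ => //.
    by rewrite mulr_ge0 ?powR_ge0// mulr_ge0// exprn_ge0.
  + apply: bounded_sums_geometric; rewrite mulr_ge0 ?powR_ge0 ?invr_ge0//=.
    rewrite ltr_pdivrMr// mul1r -[ltRHS]powRr1//.
    by rewrite /powR gt_eqF// ltr_expR ltr_pM2r// ln_gt0// ltr1n.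
Qed.

(* The positivity clause is not implied by the summability one, since
   0 `^ (- theta) = 0. *)
Lemma ae_small_divisors : {ae lebesgue_rV R d, forall x : 'rV[R]_d,
  (forall m, m != 0 -> a m != 0 -> 0 < dist_int (dot_int m x)) /\
  bounded_sums (fun m => if m == 0 then 0
                         else a m * dist_int (dot_int m x) `^ (- theta))}.
Proof.
have /andP[q0 q1] := q01.
(* One null set serves all integers [M]; afterwards [M] may depend on [x]. *)
have : {ae lebesgue_rV R d, forall x (M : nat),
    bounded_sums (fun i => w i * \1_(A M i) x)}.
  by apply: ae_foralln => M; exact: ae_w.
apply: filterS => x hx.
have [M xM] : exists M : nat, cube d M%:R x.
  exists (Num.truncn (\sum_i `|x ord0 i|)).+1 => i.
  apply: ltW; apply: le_lt_trans (truncnS_gt _).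
  by rewrite (bigD1 i)//= lerDl sumr_ge0.
have {hx} hw := hx M; have [C hC] := hw.
have w1 m j : m != 0 -> dist_int (dot_int m x) < 2^-1 ^+ j ->
    w (m, j) * \1_(A M (m, j)) x = w (m, j).
  move=> m0 hj; rewrite indicE mem_set ?mulr1// /A/= (negbTE m0).
  by split => //=; rewrite addr0; exact: dist_int_near_int.
have dpos m : m != 0 -> a m != 0 -> 0 < dist_int (dot_int m x).
  move=> m0 am; rewrite lt_neqAle dist_int_ge0 andbT eq_sym.
  apply/eqP => dm.
  have am0 : 0 < a m `^ q by rewrite powR_gt0// lt_neqAle eq_sym am a0.
  (* If [||m.x|| = 0], then [x] lies in [A M (m, j)] for every [j], each time with weight at least
     [a m ^ q]; [n] of these terms already exceed [C]. *)
  pose n := (Num.truncn (C / a m `^ q)).+1.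
  have := hC [seq (m, j) | j <- iota 0 n].
  rewrite map_inj_uniq; last by move=> i j [].
  move=> /(_ (iota_uniq _ _)); rewrite big_map leNgt => /negP; apply.
  apply: (@lt_le_trans _ _ (\sum_(j <- iota 0 n) a m `^ q)).
    rewrite big_const_seq count_predT size_iota iter_addr_0 -[ltRHS]mulr_natl.
    by rewrite -ltr_pdivrMr//; exact: truncnS_gt.
  apply: ler_sum => j _; rewrite w1//; last first.
    by rewrite dm exprn_gt0 ?invr_gt0.
  rewrite /w/= ler_peMr ?powR_ge0// exprn_ege1//.
  by rewrite -[leLHS](powRr0 2) ler_powR ?ler1n// mulr_ge0 ?(ltW theta0) ?(ltW q0).
split => //.
apply: (bounded_sums_powR (q := q)) => //.
  by move=> m; case: ifP => // _; rewrite mulr_ge0 ?powR_ge0.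
(* Each relevant [m] selects the dyadic shell containing [||m.x||]. Since [m] maps injectively to
   [(m, j m)], the wanted series is dominated by part of the double series. *)
have /choice[j hj] (m : 'rV[int]_d) : exists j, m != 0 -> a m != 0 ->
    2^-1 ^+ j.+1 <= dist_int (dot_int m x) < 2^-1 ^+ j.
  have [m0|m0] := eqVneq m 0; first by exists 0%N.
  have [am|am] := eqVneq (a m) 0; first by exists 0%N.
  have [j [h1 h2]] := ex_dyadic (dpos _ m0 am) (dist_int_lt1 _).
  by exists j => _ _; apply/andP.
apply: (@bounded_sums_le _ _ _ ((fun i => w i * \1_(A M i) x) \o (fun m => (m, j m)))).
  move=> m /=; have w0 : 0 <= w (m, j m) * \1_(A M (m, j m)) x.
    by rewrite mulr_ge0// mulr_ge0 ?powR_ge0 ?exprn_ge0 ?powR_ge0.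
  case: ifPn => [_|m0]; first by rewrite powR0 ?gt_eqF.
  have [am|am] := eqVneq (a m) 0; first by rewrite am mul0r powR0 ?gt_eqF.
  have /andP[h1 h2] := hj _ m0 am.
  rewrite w1// /w/= powRM ?powR_ge0// ler_wpM2l ?powR_ge0//.
  rewrite -powRrM mulNr -/p.
  have -> : (2 `^ p) ^+ (j m).+1 = (2^-1 ^+ (j m).+1) `^ (- p).
    rewrite -powR_mulrn ?powR_ge0// -powRrM mulrC powRrM powR_mulrn//.
    rewrite exprVn -powR_inv1 ?exprn_ge0// -[RHS]powRrM mulN1r opprK//.
  apply: ler_powRN => //; first by rewrite mulr_ge0 ?(ltW theta0) ?(ltW q0).
by apply: bounded_sums_inj => // m m' [].
Qed.

End small_divisors.

(** * The one-dimensional Fejer kernel *)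

Section bounded_measurable.
Context d (T : measurableType d) (R : realType).
Variables (mu : {measure set T -> \bar R}) (D : set T).
Hypotheses (mD : measurable D) (Dfin : (mu D < +oo)%E).

(** On a set of finite measure this implies integrability and, unlike integrability, it is stable
    under products. *)
Definition bounded_measurable (u : T -> R) :=
  measurable_fun setT u /\ exists B, forall x, D x -> `|u x| <= B.

Lemma bounded_measurable_cst c : bounded_measurable (fun=> c).
Proof. by split => //; exists `|c|. Qed.

Lemma bounded_measurableD u v : bounded_measurable u -> bounded_measurable v ->
  bounded_measurable (fun x => u x + v x).
Proof.
move=> [mu' [B hB]] [mv [C hC]]; split; first exact: measurable_funD.
exists (B + C) => x Dx; apply: le_trans (ler_normD _ _) _.
by rewrite lerD ?hB ?hC.
Qed.

Lemma bounded_measurableM u v : bounded_measurable u -> bounded_measurable v ->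
  bounded_measurable (fun x => u x * v x).
Proof.
move=> [mu' [B hB]] [mv [C hC]]; split; first exact: measurable_funM.
by exists (B * C) => x Dx; rewrite normrM ler_pM ?hB ?hC.
Qed.

Lemma bounded_measurable_sum (I : Type) (s : seq I) (u : I -> T -> R) :
  (forall i, bounded_measurable (u i)) ->
  bounded_measurable (fun x => \sum_(i <- s) u i x).
Proof.
move=> hu; elim: s => [|i s IH].
  under eq_fun do rewrite big_nil; exact: bounded_measurable_cst.
by under eq_fun do rewrite big_cons; exact: bounded_measurableD.
Qed.

Lemma bounded_measurable_prod (I : Type) (s : seq I) (u : I -> T -> R) :
  (forall i, bounded_measurable (u i)) ->
  bounded_measurable (fun x => \prod_(i <- s) u i x).
Proof.
move=> hu; elim: s => [|i s IH].
  under eq_fun do rewrite big_nil; exact: bounded_measurable_cst.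
by under eq_fun do rewrite big_cons; exact: bounded_measurableM.
Qed.

Lemma bounded_measurable_integrable u : bounded_measurable u ->
  mu.-integrable D (EFin \o u).
Proof.
move=> [mu' [B hB]]; apply: measurable_bounded_integrable => //.
  exact: measurable_funTS.
exists B; split; first exact: num_real.
by move=> M BM x Dx; apply: le_trans (hB _ Dx) (ltW BM).
Qed.

Lemma Rintegral_sum (I : Type) (s : seq I) (u : I -> T -> R) :
  (forall i, bounded_measurable (u i)) ->
  \int[mu]_(x in D) (\sum_(i <- s) u i x) =
  \sum_(i <- s) \int[mu]_(x in D) u i x.
Proof.
move=> hu; elim: s => [|i s IH].
  under eq_Rintegral do rewrite big_nil.
  by rewrite big_nil Rintegral_cst// mul0r.
under eq_Rintegral do rewrite big_cons.
rewrite big_cons -IH RintegralD//; apply: bounded_measurable_integrable => //.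
exact: bounded_measurable_sum.
Qed.

End bounded_measurable.

Section trigonometry.
Context {R : realType}.
Implicit Types (s t : R).

Lemma e2piD s t : e2pi (s + t) = e2pi s * e2pi t.
Proof.
rewrite /e2pi mulrDr cosD sinD; apply/eqP; rewrite eq_complex /=.
by apply/andP; split; apply/eqP; ring.
Qed.

Lemma e2pi0 : e2pi (0 : R) = 1.
Proof. by rewrite /e2pi mulr0 cos0 sin0. Qed.

Lemma normc_e2pi t : ComplexField.Normc.normc (e2pi t) = 1.
Proof. by rewrite /e2pi/= cos2Dsin2 sqrtr1. Qed.

Lemma e2pi_sum (I : Type) (r : seq I) (F : I -> R) :
  e2pi (\sum_(i <- r) F i) = \prod_(i <- r) e2pi (F i).
Proof. by apply: (big_morph _ e2piD e2pi0). Qed.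

Lemma cos2pi_nat (n : nat) t : cos (2 * pi * (t + n%:R)) = cos (2 * pi * t).
Proof.
rewrite mulrDr (_ : 2 * pi * n%:R = (pi *+ 2) *+ n); last first.
  by rewrite -mulr_natr -[in RHS]mulr_natr; ring.
exact: periodicn (@cosD2pi R) _ _.
Qed.

Lemma sin2pi_nat (n : nat) t : sin (2 * pi * (t + n%:R)) = sin (2 * pi * t).
Proof.
rewrite mulrDr (_ : 2 * pi * n%:R = (pi *+ 2) *+ n); last first.
  by rewrite -mulr_natr -[in RHS]mulr_natr; ring.
exact: periodicn (@sinD2pi R) _ _.
Qed.

Lemma cos2pi_int (n : int) t : cos (2 * pi * (t + n%:~R)) = cos (2 * pi * t).
Proof.
case: n => n; first exact: cos2pi_nat.
by rewrite NegzE mulrNz -[in RHS](subrK n.+1%:R t) cos2pi_nat.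
Qed.

Lemma sin2pi_int (n : int) t : sin (2 * pi * (t + n%:~R)) = sin (2 * pi * t).
Proof.
case: n => n; first exact: sin2pi_nat.
by rewrite NegzE mulrNz -[in RHS](subrK n.+1%:R t) sin2pi_nat.
Qed.

Let mu := @lebesgue_measure R.
Let I01 : set (measurableTypeR R) := `[0, 1[%classic.

Lemma measurable_I01 : measurable I01.
Proof. exact: measurable_itv. Qed.

Lemma lebesgue_I01 : mu I01 = 1%E.
Proof.
rewrite [LHS](lebesgue_measure_itv `[0, 1[)/= lte_fin ltr01.
by rewrite oppr0 adde0.
Qed.

Lemma bounded_measurable_cos2pi (D : set (measurableTypeR R)) (a s : R) :
  bounded_measurable D (fun t => cos (2 * pi * (a * (s - t)))).
Proof.
split.
  apply: (@measurableT_comp _ _ _ _ _ _ (@cos R)).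
    apply: continuous_measurable_fun; exact: continuous_cos.
  apply: measurable_funM => //; apply: measurable_funM => //.
  exact: measurable_funB.
by exists 1 => x _; rewrite ler_norml cos_geN1 cos_le1.
Qed.

(** For [k != 0] the primitive [F] takes the same value at [0] and [1], because [k] is an
    integer. *)
Lemma Rintegral_cos2pi (k : int) s :
  \int[mu]_(t in I01) cos (2 * pi * (k%:~R * (s - t))) = (k == 0)%:R.
Proof.
have [->|k0] := eqVneq k 0.
  under eq_Rintegral do rewrite mul0r mulr0 cos0.
  rewrite Rintegral_cst; last exact: measurable_I01.
  by rewrite [X in fine X]lebesgue_I01/= mulr1.
have pi0 : pi != 0 :> R by rewrite gt_eqF ?pi_gt0.
have kR : k%:~R != 0 :> R by rewrite intr_eq0.
pose c : R := 2 * pi * k%:~R.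
have c0 : c != 0 by rewrite !mulf_neq0.
pose F (t : R) := - c^-1 * sin (c * s - c * t).
have dF (t : R) : is_derive t 1 F (cos (2 * pi * (k%:~R * (s - t)))).
  rewrite /F; apply: is_derive_eq.
  rewrite /GRing.scale/= /GRing.scale/=.
  have -> : 2 * pi * (k%:~R * (s - t)) = c * s - c * t by rewrite /c; ring.
  by rewrite mulr1 add0r mul1r mulrN mulrNN mulrC mulfK.
have cont (g : R -> R) t (g' : R) : is_derive t 1 g g' -> {for t, continuous g}.
  by move=> [dg _]; apply/differentiable_continuous/derivable1_diffP.
rewrite /I01 (Rintegral_itv_bndo_bndc (a := BLeft 0) (r := 1)); last first.
  apply: (bounded_measurable_integrable (D := I01)); first exact: measurable_I01.
    by rewrite [ltLHS]lebesgue_I01 ltry.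
  exact: bounded_measurable_cos2pi.
rewrite /Rintegral (@continuous_FTC2 _ _ F) //=.
- rewrite /F !mulr0 subr0 mulr1.
  have -> : c * s - c = 2 * pi * (k%:~R * s + (- k)%:~R).
    by rewrite mulrNz /c; ring.
  by rewrite sin2pi_int mulrA subrr.
- apply: continuous_subspaceT => t.
  apply: continuous_comp; last exact: continuous_cos.
  apply: cvgM; first exact: cvg_cst.
  by apply: cvgM; [exact: cvg_cst|apply: cvgB => //; exact: cvg_cst].
- split.
  + by move=> t _; have [] := dF t.
  + by apply: cvg_at_right_filter; exact: cont (dF 0).
  + by apply: cvg_at_left_filter; exact: cont (dF 1).
- by move=> t _; rewrite derive1E; have [_ ->] := dF t.
Qed.

(** This is [L^-1 |\sum_(j < L) e2pi (j t)|^2], written over the reals so that its sign is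
    visible. *)
Definition fejer (L : nat) t : R :=
  L%:R^-1 * ((\sum_(j < L) cos (2 * pi * (j%:R * t))) ^+ 2 +
             (\sum_(j < L) sin (2 * pi * (j%:R * t))) ^+ 2).

Lemma fejer_ge0 L t : 0 <= fejer L t.
Proof. by rewrite mulr_ge0 ?invr_ge0// addr_ge0 ?sqr_ge0. Qed.

Lemma fejerE L t : fejer L t =
  L%:R^-1 * \sum_(j < L) \sum_(l < L) cos (2 * pi * ((j%:Z - l%:Z)%:~R * t)).
Proof.
rewrite /fejer; congr (_ * _); rewrite !expr2 !mulr_suml -big_split.
apply: eq_bigr => j _ /=; rewrite !mulr_sumr -big_split; apply: eq_bigr => l _ /=.
by rewrite -cosB rmorphB/=; congr cos; ring.
Qed.

(** Take squared moduli in the geometric sum [(e2pi t - 1) \sum_(j < L) e2pi (j t) = e2pi (L t) -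
    1], using [|e2pi t - 1|^2 = 2 (1 - cos (2 pi t))]. *)
Lemma fejerM1cos L t : (0 < L)%N ->
  (1 - cos (2 * pi * t)) * fejer L t = (1 - cos (2 * pi * (L%:R * t))) / L%:R.
Proof.
move=> L0; rewrite /fejer mulrCA [RHS]mulrC; congr (_ * _).
set th := 2 * pi * t.
have thE (n : nat) : 2 * pi * (n%:R * t) = n%:R * th by rewrite /th; ring.
rewrite thE; set A := \sum_(j < L) cos _; set B := \sum_(j < L) sin _.
have AE : A = \sum_(j < L) cos (j%:R * th) by apply: eq_bigr => j _; rewrite thE.
have BE : B = \sum_(j < L) sin (j%:R * th) by apply: eq_bigr => j _; rewrite thE.
(* Real and imaginary parts of the geometric sum identity. *)
have [h1 h2] : (cos th - 1) * A - sin th * B = cos (L%:R * th) - 1 /\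
    (cos th - 1) * B + sin th * A = sin (L%:R * th).
  rewrite AE BE; elim: (L) => [|n [IH1 IH2]].
    by rewrite !big_ord0 mul0r cos0 sin0; split; ring.
  rewrite !big_ord_recr/= -(natr1 n) (mulrDl n%:R) mul1r cosD sinD.
  by split; [rewrite -[cos (n%:R * th)](subrK 1) -IH1|rewrite -IH2]; ring.
have e1 := cos2Dsin2 th; have e2 := cos2Dsin2 (L%:R * th).
apply: (@mulfI _ 2) => //.
transitivity ((cos (L%:R * th) - 1) ^+ 2 + sin (L%:R * th) ^+ 2).
  rewrite -h1 -h2.
  have -> : 2 * ((1 - cos th) * (A ^+ 2 + B ^+ 2)) =
     (cos th ^+ 2 + sin th ^+ 2 + 1 - 2 * cos th) * (A ^+ 2 + B ^+ 2).
    by rewrite e1; ring.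
  by ring.
transitivity (cos (L%:R * th) ^+ 2 + sin (L%:R * th) ^+ 2 + 1 - 2 * cos (L%:R * th)).
  by ring.
by rewrite e2; ring.
Qed.

Lemma bounded_measurable_fejer (D : set (measurableTypeR R)) L s :
  bounded_measurable D (fun t => fejer L (s - t)).
Proof.
under eq_fun do rewrite fejerE.
apply: bounded_measurableM; first exact: bounded_measurable_cst.
do 2!(apply: bounded_measurable_sum => ?).
exact: bounded_measurable_cos2pi.
Qed.

(** In [fejerE] only the [L] diagonal terms [j = l] have nonzero integral. *)
Lemma Rintegral_fejer L s : (0 < L)%N -> \int[mu]_(t in I01) fejer L (s - t) = 1.
Proof.
move=> L0; have mI := measurable_I01.
have fI : (mu I01 < +oo)%E by rewrite lebesgue_I01 ltry.
under eq_Rintegral do rewrite fejerE.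
rewrite RintegralZl//; last first.
  apply: bounded_measurable_integrable => //.
  do 2!(apply: bounded_measurable_sum => ?).
  exact: bounded_measurable_cos2pi.
rewrite Rintegral_sum//; last first.
  move=> j; apply: bounded_measurable_sum => l.
  exact: bounded_measurable_cos2pi.
under eq_bigr => j _.
  rewrite Rintegral_sum//; last by move=> l; exact: bounded_measurable_cos2pi.
  under eq_bigr do rewrite Rintegral_cos2pi.
  rewrite (bigD1 j)//= subrr eqxx big1 ?addr0; last first.
    move=> l lj; rewrite subr_eq0 eqz_nat; case: eqP => // /ord_inj jl.
    by rewrite jl eqxx in lj.
  over.
by rewrite sumr_const card_ord mulVf// pnatr_eq0 -lt0n.
Qed.

(** By [fejerM1cos] the integrand is [(1 - cos (2 pi L (s - t))) / L], whose cosine integrates to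
    [0]. This measures the concentration of the kernel near [s] modulo [1]. *)
Lemma Rintegral_fejerM1cos L s : (0 < L)%N ->
  \int[mu]_(t in I01) ((1 - cos (2 * pi * (s - t))) * fejer L (s - t)) = L%:R^-1.
Proof.
move=> L0; have mI := measurable_I01.
have fI : (mu I01 < +oo)%E by rewrite lebesgue_I01 ltry.
under eq_Rintegral do rewrite fejerM1cos//.
have hc := bounded_measurable_cos2pi I01 L%:R s.
rewrite RintegralZr//; last first.
  apply: (bounded_measurable_integrable mI fI).
  apply: bounded_measurableD; first exact: bounded_measurable_cst.
  by under eq_fun do rewrite -mulN1r; apply: bounded_measurableM => //;
    exact: bounded_measurable_cst.
rewrite RintegralB//; try exact: (bounded_measurable_integrable mI fI).
  rewrite (Rintegral_cos2pi L%:Z) eqz_nat gtn_eqF// subr0.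
  by rewrite Rintegral_cst// [X in fine X]lebesgue_I01/= !mul1r.
by apply: (bounded_measurable_integrable mI fI); exact: bounded_measurable_cst.
Qed.

End trigonometry.

(** * The Fejer kernel on the torus *)

Section continuous_rV.
Context {R : realType} (n : nat).
Implicit Types u : 'rV[R]_n -> R.

(** An open set is the countable union of the boxes with rational centre and radius [1/(k+1)] that
    it contains; this links the topology to the product sigma-algebra. *)
Lemma open_measurable_rV (U : set 'rV[R]_n) : open U -> measurable U.
Proof.
move=> oU.
pose B (i : 'rV[rat]_n * nat) : set 'rV[R]_n :=
  [set x | forall j, `|ratr (i.1 ord0 j) - x ord0 j| < i.2.+1%:R^-1].
pose F i := if `[< B i `<=` U >] then B i else set0.
have -> : U = \bigcup_i F i.
  apply/seteqP; split=> [x Ux|x [i _]]; last first.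
    by rewrite /F; case: asboolP => // h Bx; exact: h.
  have /nbhs_ballP[e /= e0 eU] : nbhs x U by exact: open_nbhs_nbhs.
  (* With [2 r <= e], a box of radius [r] whose centre is within [r] of [x] stays inside the ball of
     radius [e] around [x]. *)
  pose k := Num.truncn (2 / e); pose r : R := k.+1%:R^-1.
  have r0 : 0 < r by rewrite invr_gt0.
  have re : 2 * r <= e.
    rewrite /r ler_pdivrMr// mulrC -ler_pdivrMr//.
    by apply: ltW; exact: truncnS_gt.
  have /choice[c hc] (j : 'I_n) : exists c : rat, `|ratr c - x ord0 j| < r.
    have [|c] := @rat_in_itvoo R (x ord0 j - r) (x ord0 j + r).
      by rewrite ltrBlDr -addrA ltrDl addr_gt0.
    by rewrite in_itv/= => hc; exists c; rewrite ltr_distl.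
  have cU : B (\row_j c j, k) `<=` U.
    move=> y hy; apply: eU; split=> // i j; rewrite ord1 /ball/=.
    rewrite -(subrK (ratr (c j)) (x ord0 j)) -addrA.
    apply: le_lt_trans (ler_normD _ _) _; apply: lt_le_trans re.
    rewrite mulr_natl mulr2n ltrD//; first by rewrite distrC.
    by have := hy j; rewrite /= mxE.
  exists (\row_j c j, k) => //; rewrite /F; case: asboolP => // _ j /=.
  by rewrite mxE; exact: hc.
apply: countable_bigcupT_measurable; first exact: countableP.
move=> i; rewrite /F; case: asboolP => // _.
rewrite (_ : B i = \bigcap_(j in [set: 'I_n])
    ((fun x : 'rV[R]_n => x ord0 j) @^-1` ball (ratr (i.1 ord0 j) : R) i.2.+1%:R^-1)).
  apply: fin_bigcap_measurable => // j _; rewrite -[X in measurable X]setTI.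
  by apply: (@measurable_coord_rV _ R) => //; exact: measurable_ball.
by apply/seteqP; split => [x h j _|x h j]; [exact: h|exact: (h j Logic.I)].
Qed.

Lemma continuous_measurable_fun_rV u : continuous u -> measurable_fun setT u.
Proof.
move=> /continuousP cu; apply: (measurability _ (RGenOpens.measurableE R)).
move=> _ [_ [a [b ->] <-]]; rewrite setTI; apply: open_measurable_rV.
by apply: cu; exact: (@interval_open R (BRight a) (BLeft b) isT isT).
Qed.

Lemma continuous_bounded_cube u : continuous u ->
  exists B, forall x, unit_cube x -> `|u x| <= B.
Proof.
move=> cu; pose K := [set x : 'rV[R]_n | forall i, `[0, 1]%classic (x ord0 i)].
have cK : compact K.
  have := @rV_compact (R : ptopologicalType) n (fun=> `[0, 1]%classic); apply.
  by move=> _; exact: segment_compact.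
have : compact (u @` K).
  by apply: continuous_compact => //; exact: continuous_subspaceT.
move=> /compact_bounded[M [_ hM]]; exists (M + 1) => x xI.
apply: (hM (M + 1)); first by rewrite ltrDl.
exists x => // i; have /andP[? ?] := xI i.
by rewrite /= in_itv/=; apply/andP; split => //; exact: ltW.
Qed.

Lemma continuous_bounded_measurable u :
  continuous u -> bounded_measurable (@unit_cube R n) u.
Proof.
by move=> cu; split; [exact: continuous_measurable_fun_rV|exact: continuous_bounded_cube].
Qed.

End continuous_rV.

(** * Product integrals over the unit cube and the Fejer approximate identity *)

Section cube.
Context {R : realType}.
Let mu := @lebesgue_measure R.
Let I01 : set (measurableTypeR R) := `[0, 1[%classic.

Lemma unit_cubeE n : @unit_cube R n = [set x | forall i, I01 (x ord0 i)].
Proof.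
by apply/seteqP; split => x h i; have := h i; rewrite /I01/= in_itv.
Qed.

Lemma measurable_unit_cube n : measurable (@unit_cube R n).
Proof.
rewrite unit_cubeE [X in measurable X](_ : _ = \bigcap_(j in [set: 'I_n])
    ((fun x : 'rV[R]_n => x ord0 j) @^-1` I01)).
  apply: fin_bigcap_measurable => // j _; rewrite -[X in measurable X]setTI.
  by apply: (@measurable_coord_rV _ R) => //; exact: measurable_I01.
by apply/seteqP; split => [x h j _|x h j]; [exact: h|exact: (h j Logic.I)].
Qed.

Lemma lebesgue_unit_cube n : lebesgue_rV R n (@unit_cube R n) = 1%E.
Proof.
rewrite unit_cubeE (lebesgue_rV_box (A := fun=> I01)).
  by rewrite big1// => i _; exact: lebesgue_I01.
by move=> _; exact: measurable_I01.
Qed.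

Lemma unit_cube_lty n : (lebesgue_rV R n (@unit_cube R n) < +oo)%E.
Proof. by rewrite lebesgue_unit_cube ltry. Qed.

Lemma measurable_prod_coord n (h : 'I_n -> measurableTypeR R -> R) :
  (forall i, measurable_fun setT (h i)) ->
  measurable_fun setT (fun x : 'rV[R]_n => \prod_(i < n) h i (x ord0 i)).
Proof.
move=> mh; apply: measurable_prod => i _.
exact: (measurableT_comp (mh i) (@measurable_coord_rV _ R _ i)).
Qed.

(** Induction following the construction of [lebesgue_rV] as the image of a product measure under
    [cons_rV]; nonnegativity allows Tonelli at each step. *)
Lemma tonelli_rV n (h : 'I_n -> measurableTypeR R -> R) :
  (forall i, measurable_fun setT (h i)) -> (forall i t, 0 <= h i t) ->
  (\int[lebesgue_rV R n]_x (\prod_(i < n) h i (x ord0 i))%:E =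
   \prod_(i < n) \int[mu]_t (h i t)%:E)%E.
Proof.
elim: n h => [|n IH] h mh h0.
  under eq_integral do rewrite big_ord0.
  by rewrite big_ord0 /= integral_dirac//= diracT mul1e.
pose g (y : 'rV[R]_n) := \prod_(i < n) h (lift ord0 i) (y ord0 i).
have mg : measurable_fun setT g.
  exact: (@measurable_prod_coord _ (fun i => h (lift ord0 i))).
have g0 y : 0 <= g y by exact: prodr_ge0.
rewrite /= ge0_integral_pushforward//; last 3 first.
- exact: measurable_cons_rV.
- by apply/measurable_EFinP; exact: measurable_prod_coord.
- by move=> y _; rewrite lee_fin prodr_ge0.
pose H (p : measurableTypeR R * 'rV[R]_n) : \bar R := (h ord0 p.1 * g p.2)%:E.
have HE : (fun y : 'rV[R]_n.+1 => (\prod_(i < n.+1) h i (y ord0 i))%:E)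
    \o @cons_rV R n = H.
  apply/funext => -[a v]; rewrite /H /g /= big_ord_recl cons_rVE0.
  by congr (_ * _)%:E; apply: eq_bigr => i _; rewrite cons_rVES.
have mH : measurable_fun setT H.
  apply/measurable_EFinP; apply: measurable_funM.
    exact: (measurableT_comp (mh ord0) measurable_fst).
  exact: (measurableT_comp mg measurable_snd).
have H0 p : (0 <= H p)%E by rewrite lee_fin mulr_ge0.
rewrite preimage_setT HE fubini_tonelli1//= /fubini_F.
under eq_integral => a _.
  under eq_integral do rewrite /H/= EFinM.
  rewrite ge0_integralZl_EFin//; [|by move=> y _; rewrite lee_fin|exact/measurable_EFinP].
  over.
rewrite /= ge0_integralZr//; last 3 first.
- exact/measurable_EFinP.
- by move=> y _; rewrite lee_fin.
- by apply: integral_ge0 => y _; rewrite lee_fin.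
by rewrite big_ord_recl; congr (_ * _)%E; exact: (IH (fun i => h (lift ord0 i))).
Qed.

Lemma Rintegral_prod_cube n (h : 'I_n -> measurableTypeR R -> R) :
  (forall i, bounded_measurable I01 (h i)) -> (forall i t, 0 <= h i t) ->
  \int[lebesgue_rV R n]_(x in @unit_cube R n) (\prod_(i < n) h i (x ord0 i)) =
  \prod_(i < n) \int[mu]_(t in I01) h i t.
Proof.
move=> hb h0; have mI := @measurable_I01 R.
have fI : (mu I01 < +oo)%E by rewrite /mu lebesgue_I01 ltry.
rewrite /Rintegral integral_mkcond.
(* The indicator of the cube is the product of the indicators of its sides, which are absorbed into
   the factors. *)
pose k i (t : measurableTypeR R) := h i t * \1_I01 t.
have -> : (fun x => (\prod_(i < n) h i (x ord0 i))%:E) \_ (@unit_cube R n) =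
    (fun x => (\prod_(i < n) k i (x ord0 i))%:E).
  apply/funext => x; rewrite /patch; case: ifPn => [|/negP xI].
    rewrite inE unit_cubeE => xI; congr EFin; apply: eq_bigr => i _.
    by rewrite /k indicE mem_set ?mulr1//; exact: xI.
  have [i /negP hi] : exists i, ~ I01 (x ord0 i).
    apply/existsNP => hx; apply: xI; rewrite inE unit_cubeE.
    exact: hx.
  rewrite (bigD1 i)//= /k indicE (negbTE (_ : x ord0 i \notin I01)) ?mulr0 ?mul0r//.
  by rewrite notin_setE; exact/negP.
rewrite tonelli_rV; first last.
- by move=> i t; rewrite mulr_ge0.
- by move=> i; apply: measurable_funM; [case: (hb i)|exact: measurable_indic].
have -> : (\prod_(i < n) \int[mu]_t (k i t)%:E =
    \prod_(i < n) (\int[mu]_(t in I01) h i t)%:E)%E.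
  apply: eq_bigr => i _; rewrite /Rintegral fineK; last first.
    apply: integrable_fin_num => //.
    exact: (bounded_measurable_integrable mI fI (hb i)).
  rewrite [RHS]integral_mkcond; apply: eq_integral => t _.
  by rewrite /k /patch indicE; case: ifP; rewrite ?mulr1 ?mulr0.
by rewrite prodEFin.
Qed.

Section approximate_identity.
Variables (n L : nat) (x : 'rV[R]_n).
Hypothesis L0 : (0 < L)%N.
Let nu := lebesgue_rV R n.
Let Q := @unit_cube R n.

Definition fejer_rV (y : 'rV[R]_n) : R :=
  \prod_(i < n) fejer L (x ord0 i - y ord0 i).

Lemma fejer_rV_ge0 y : 0 <= fejer_rV y.
Proof. by apply: prodr_ge0 => i _; exact: fejer_ge0. Qed.

Lemma bounded_measurable_coord (g : measurableTypeR R -> R) (i : 'I_n) :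
  bounded_measurable I01 g -> bounded_measurable Q (fun y => g (y ord0 i)).
Proof.
move=> [mg [B hB]]; split.
  exact: (measurableT_comp mg (@measurable_coord_rV _ R _ i)).
by exists B => y; rewrite /Q unit_cubeE => /(_ i); exact: hB.
Qed.

Lemma bounded_measurable_fejer_rV : bounded_measurable Q fejer_rV.
Proof.
apply: bounded_measurable_prod => i.
apply: (bounded_measurable_coord (g := fun t => fejer L (x ord0 i - t))).
exact: bounded_measurable_fejer.
Qed.

Lemma Rintegral_fejer_rV : \int[nu]_(y in Q) fejer_rV y = 1.
Proof.
rewrite (Rintegral_prod_cube (h := fun i t => fejer L (x ord0 i - t))).
- by rewrite big1// => i _; exact: Rintegral_fejer.
- by move=> i; exact: bounded_measurable_fejer.
- by move=> i t; exact: fejer_ge0.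
Qed.

Let cosk (i : 'I_n) (y : 'rV[R]_n) := 1 - cos (2 * pi * (x ord0 i - y ord0 i)).

Lemma bounded_measurable_1cos (D : set (measurableTypeR R)) (s : R) :
  bounded_measurable D (fun t => 1 - cos (2 * pi * (s - t))).
Proof.
apply: bounded_measurableD; first exact: bounded_measurable_cst.
under eq_fun do rewrite -mulN1r -[s - _]mul1r.
apply: bounded_measurableM; first exact: bounded_measurable_cst.
exact: bounded_measurable_cos2pi.
Qed.

(** The integrand is still a product: the factor of index [i] integrates to [1/L] and all others to
    [1]. *)
Lemma Rintegral_fejer_rVM1cos (i : 'I_n) :
  \int[nu]_(y in Q) (cosk i y * fejer_rV y) = L%:R^-1.
Proof.
pose h (k : 'I_n) t := (if k == i then 1 - cos (2 * pi * (x ord0 k - t)) else 1)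
  * fejer L (x ord0 k - t).
have hE y : cosk i y * fejer_rV y = \prod_(k < n) h k (y ord0 k).
  rewrite /fejer_rV /h [RHS]big_split/=; congr (_ * _).
  rewrite (bigD1 i)//= eqxx big1 ?mulr1// => k ki.
  by rewrite (negbTE ki).
under eq_Rintegral do rewrite hE.
rewrite (Rintegral_prod_cube (h := h)).
- rewrite (bigD1 i)//= /h eqxx Rintegral_fejerM1cos// big1 ?mulr1// => k ki.
  rewrite (negbTE ki); under eq_Rintegral do rewrite mul1r.
  exact: Rintegral_fejer.
- move=> k; apply: bounded_measurableM; last exact: bounded_measurable_fejer.
  by case: (k == i); [exact: bounded_measurable_1cos|exact: bounded_measurable_cst].
- move=> k t; rewrite mulr_ge0 ?fejer_ge0//; case: (k == i) => //.
Qed.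

(** The kernel is nonnegative with integral [1], so the difference is the integral of
    [(u y - c) * fejer_rV y]. Integrating the assumed bound against the kernel yields [e] plus [C]
    times [n] terms [1/L]. *)
Lemma fejer_rV_approx (u : 'rV[R]_n -> R) (c e C : R) :
  bounded_measurable Q u ->
  (forall y, Q y -> `|u y - c| <=
     e + C * \sum_(i < n) (1 - cos (2 * pi * (x ord0 i - y ord0 i)))) ->
  `|\int[nu]_(y in Q) (u y * fejer_rV y) - c| <= e + C * (n%:R / L%:R).
Proof.
move=> hu uc; have mQ : measurable Q by exact: measurable_unit_cube.
have fQ : (nu Q < +oo)%E by exact: unit_cube_lty.
have bF := bounded_measurable_fejer_rV.
have bcst r : bounded_measurable Q (fun=> r) := bounded_measurable_cst _ r.
have bint v := @bounded_measurable_integrable _ _ _ nu Q mQ fQ v.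
have bcos i : bounded_measurable Q (cosk i).
  apply: (bounded_measurable_coord (g := fun t => 1 - cos (2 * pi * (x ord0 i - t)))).
  exact: bounded_measurable_1cos.
have buc : bounded_measurable Q (fun y => (u y - c) * fejer_rV y).
  by apply: bounded_measurableM => //; apply: bounded_measurableD.
have -> : \int[nu]_(y in Q) (u y * fejer_rV y) - c =
    \int[nu]_(y in Q) ((u y - c) * fejer_rV y).
  under [RHS]eq_Rintegral do rewrite mulrBl.
  rewrite RintegralB//; [|exact/bint/bounded_measurableM|exact/bint/bounded_measurableM].
  by rewrite RintegralZl ?Rintegral_fejer_rV ?mulr1//; exact: bint.
apply: le_trans (le_normr_Rintegral mQ (bint _ buc)) _.
have bsum : bounded_measurable Q (fun y => \sum_(i < n) cosk i y * fejer_rV y).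
  by apply: bounded_measurable_sum => i; exact: bounded_measurableM.
apply: (@le_trans _ _ (\int[nu]_(y in Q)
    (e * fejer_rV y + C * \sum_(i < n) cosk i y * fejer_rV y))).
  apply: le_Rintegral => //.
  - by have := integrable_norm (bint _ buc).
  - by apply: bint; apply: bounded_measurableD; apply: bounded_measurableM.
  - move=> y Qy; rewrite normrM (ger0_norm (fejer_rV_ge0 y)) -mulr_suml mulrA -mulrDl.
    by rewrite ler_wpM2r ?fejer_rV_ge0//; exact: uc.
rewrite RintegralD//; [|exact/bint/bounded_measurableM|exact/bint/bounded_measurableM].
rewrite RintegralZl//; [|exact: bint]; rewrite RintegralZl//; [|exact: bint].
rewrite Rintegral_fejer_rV mulr1 Rintegral_sum//; last first.
  by move=> i; exact: bounded_measurableM.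
under eq_bigr do rewrite Rintegral_fejer_rVM1cos.
by rewrite sumr_const card_ord mulr_natl.
Qed.

End approximate_identity.
End cube.

(** * Oscillation of a continuous periodic function *)

Section periodic_oscillation.
Context {R : realType} (d : nat).

Lemma sum_1cos_ge (x y : 'rV[R]_d) (i : 'I_d) :
  1 - cos (2 * pi * (x ord0 i - y ord0 i)) <=
  \sum_(k < d) (1 - cos (2 * pi * (x ord0 k - y ord0 k))).
Proof.
rewrite [leRHS](bigD1 i)//= lerDl sumr_ge0//.
Qed.

Lemma cos2pi_dist_le (t eta : R) : 0 < eta -> eta <= `|t| <= 2^-1 ->
  cos (2 * pi * t) <= cos (2 * pi * eta).
Proof.
move=> e0 /andP[et t2]; have p0 := @pi_gt0 R.
have -> : cos (2 * pi * t) = cos (2 * pi * `|t|).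
  have [h|h] := lerP 0 t; first by rewrite ger0_norm.
  by rewrite ltr0_norm // mulrN cosN.
have h s : 0 <= s -> s <= 2^-1 -> 2 * pi * s \in `[0, pi].
  move=> s0 s1; rewrite in_itv/=; apply/andP; split.
    by rewrite !mulr_ge0 ?pi_ge0.
  by rewrite mulrAC ler_piMl ?pi_ge0//; lra.
rewrite leNgt ltr_cos ?h ?normr_ge0//; first last.
- exact: le_trans t2.
- exact: ltW.
by rewrite -leNgt ler_pM2l// mulr_gt0.
Qed.

(* Korovkin's idea: by [fejerM1cos] the last sum integrates to O(1/L) against the
   Fejer kernel, so no tail estimate for the kernel is needed. *)
Lemma periodic_oscillation (u : 'rV[R]_d -> R) (x : 'rV[R]_d) (e : R) :
  continuous u ->
  (forall (y : 'rV[R]_d) (m : 'rV[int]_d), u (y + map_mx intr m) = u y) -> 0 < e ->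
  exists2 C, 0 <= C & forall y, unit_cube y ->
    `|u y - u x| <= e + C * \sum_(i < d) (1 - cos (2 * pi * (x ord0 i - y ord0 i))).
Proof.
move=> cu pu e0; have [B hB] := continuous_bounded_cube cu.
have /cvgrPdist_lt/(_ e e0)/nbhs_ballP[r /= r0 hr] := cu x.
(* The cap [1/4] keeps [2 pi eta] in the interval where [cos] decreases strictly, so that
   [kappa > 0]. *)
pose eta := Num.min r 4^-1.
have eta0 : 0 < eta by rewrite lt_min r0 invr_gt0 ltr0n.
have eta4 : eta <= 4^-1 by rewrite ge_min lexx orbT.
have p0 := @pi_gt0 R.
pose kappa := 1 - cos (2 * pi * eta).
have kappa0 : 0 < kappa.
  rewrite subr_gt0 -[ltRHS]cos0 ltr_cos ?in_itv/= ?lexx ?(ltW p0)//; last first.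
    rewrite !mulr_ge0 ?(ltW p0) ?(ltW eta0)//=.
    by rewrite mulrAC ler_piMl ?(ltW p0)//; lra.
  by rewrite !mulr_gt0.
pose C := (`|B| + `|u x|) / kappa.
have C0 : 0 <= C by apply: divr_ge0; [exact: addr_ge0|exact: ltW].
exists C => // y yQ.
(* The floor of the shifted difference is a nearest integer: [y'] is a translate of [y] whose
   coordinates are all within [1/2] of those of [x]. *)
pose n (i : 'I_d) := Num.floor (x ord0 i - y ord0 i + 2^-1).
pose y' := y + map_mx intr (\row_i n i).
pose s (i : 'I_d) := x ord0 i - y' ord0 i.
have sE i : s i = x ord0 i - y ord0 i - (n i)%:~R by rewrite /s !mxE; ring.
have s2 i : `|s i| <= 2^-1.
  have /andP[h1 h2] := floor_itv (x ord0 i - y ord0 i + 2^-1).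
  rewrite -/(n i) in h1 h2; rewrite intrD in h2.
  by rewrite sE ler_norml; apply/andP; split; lra.
have cosE i : cos (2 * pi * (x ord0 i - y ord0 i)) = cos (2 * pi * s i).
  by rewrite sE -[in RHS](cos2pi_int (n i)) subrK.
have [small|] := pselect (forall i, `|s i| < eta).
  rewrite -(pu y (\row_i n i)) -/y' distrC.
  apply: (@le_trans _ _ e); last first.
    by rewrite lerDl mulr_ge0// sumr_ge0// => i _; rewrite subr_ge0 cos_le1.
  apply: ltW; apply: hr; split => // i j; rewrite ord1 /ball/=.
  by apply: lt_le_trans (small j) _; rewrite ge_min lexx.
(* Some coordinate is at least [eta] away, so the cosine sum is at least [kappa]; then [C kappa]
   equals [|B| + |u x|], which bounds the oscillation outright. *)
move=> /existsNP[i /negP]; rewrite -leNgt => si.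
apply: (@le_trans _ _ (C * kappa)).
  rewrite /C divfK ?gt_eqF//; apply: le_trans (ler_normB _ _) _; rewrite lerD2r.
  exact: le_trans (hB _ yQ) (ler_norm _).
apply: (@le_trans _ _ (C * \sum_(i < d) (1 - cos (2 * pi * (x ord0 i - y ord0 i))))).
  rewrite ler_wpM2l//; apply: le_trans (sum_1cos_ge x y i).
  by rewrite /kappa lerD2l lerN2 cosE; apply: cos2pi_dist_le => //; rewrite si s2.
by rewrite lerDr ltW.
Qed.

End periodic_oscillation.

(** * Modulus, real part and imaginary part *)

Section complex_parts.
Local Notation normc := ComplexField.Normc.normc.
Context {R : realType}.
Implicit Types z : R[i].

Lemma ler_normc z : normc z <= `|complex.Re z| + `|complex.Im z|.
Proof.
case: z => a b /=; rewrite -(ler_pXn2r (n := 2))// ?nnegrE ?sqrtr_ge0 ?addr_ge0//.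
rewrite sqr_sqrtr ?addr_ge0 ?sqr_ge0// sqrrD !real_normK ?num_real//.
by rewrite lerD2r lerDl mulrn_wge0 ?mulr_ge0.
Qed.

Lemma normc_ge_norm z : `|complex.Re z| <= normc z /\ `|complex.Im z| <= normc z.
Proof.
by case: z => a b /=; split; rewrite -sqrtr_sqr ler_sqrt ?addr_ge0 ?sqr_ge0//
  ?lerDl ?lerDr sqr_ge0.
Qed.

Lemma normc_sum (I : Type) (s : seq I) (P : pred I) (F : I -> R[i]) :
  normc (\sum_(i <- s | P i) F i) <= \sum_(i <- s | P i) normc (F i).
Proof.
elim/big_rec2 : _ => [|i y z _ h]; first by rewrite ComplexField.Normc.normc0.
apply: le_trans (le_normcD _ _) _; by rewrite lerD2l.
Qed.

Lemma continuous_Re_Im (T : topologicalType) (f : T -> R[i]) :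
  continuous (f : T -> (R[i] : numFieldType)) ->
  continuous (fun x => complex.Re (f x)) /\ continuous (fun x => complex.Im (f x)).
Proof.
move=> cf.
have h x e : 0 < e -> \forall y \near x, normc (f x - f y) < e.
  move=> e0; have /cvgrPdist_lt/(_ e%:C) := cf x.
  by rewrite ltcR => /(_ e0); apply: filterS => y; rewrite normc_def ltcR; case: (f x - f y).
split => x; apply/cvgrPdist_lt => e e0; near=> y.
- have hy : normc (f x - f y) < e by near: y; exact: h.
  apply: le_lt_trans hy; rewrite -raddfB; exact: (normc_ge_norm _).1.
- have hy : normc (f x - f y) < e by near: y; exact: h.
  apply: le_lt_trans hy; rewrite -raddfB; exact: (normc_ge_norm _).2.
Unshelve. all: by end_near. Qed.

Lemma Re_sum (I : Type) (s : seq I) (F : I -> R[i]) :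
  complex.Re (\sum_(i <- s) F i) = \sum_(i <- s) complex.Re (F i).
Proof. by elim/big_rec2 : _ => // i y z _ <-; case: (F i) z => ? ? []. Qed.

Lemma Im_sum (I : Type) (s : seq I) (F : I -> R[i]) :
  complex.Im (\sum_(i <- s) F i) = \sum_(i <- s) complex.Im (F i).
Proof. by elim/big_rec2 : _ => // i y z _ <-; case: (F i) z => ? ? []. Qed.

End complex_parts.

(** * Fejer means of periodic functions *)

Section torus_integral.
Local Notation normc := ComplexField.Normc.normc.
Context {R : realType} (d : nat).
Let nu := lebesgue_rV R d.
Let Q := @unit_cube R d.
Let mQ : measurable Q := @measurable_unit_cube R d.
Let fQ : (nu Q < +oo)%E := @unit_cube_lty R d.

Definition bounded_measurableC (g : 'rV[R]_d -> R[i]) :=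
  bounded_measurable Q (fun y => complex.Re (g y)) /\
  bounded_measurable Q (fun y => complex.Im (g y)).

Let integrable_bm v : bounded_measurable Q v -> nu.-integrable Q (EFin \o v).
Proof. exact: bounded_measurable_integrable. Qed.

Let bm_cst (r : R) : bounded_measurable Q (fun=> r).
Proof. exact: bounded_measurable_cst. Qed.

Let bm_opp (v : 'rV[R]_d -> R) :
  bounded_measurable Q v -> bounded_measurable Q (fun x => - v x).
Proof.
by move=> hv; under eq_fun do rewrite -mulN1r; exact: bounded_measurableM.
Qed.

Lemma bounded_measurableCM g h : bounded_measurableC g -> bounded_measurableC h ->
  bounded_measurableC (fun y => g y * h y).
Proof.
move=> [g1 g2] [h1 h2]; split.
  rewrite (_ : (fun y => _) = (fun y => complex.Re (g y) * complex.Re (h y)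
      + - (complex.Im (g y) * complex.Im (h y)))).
    by apply: bounded_measurableD; [|apply: bm_opp]; exact: bounded_measurableM.
  by apply/funext => y; case: (g y) (h y) => ? ? [].
rewrite (_ : (fun y => _) = (fun y => complex.Re (g y) * complex.Im (h y)
      + complex.Im (g y) * complex.Re (h y))).
  by apply: bounded_measurableD; exact: bounded_measurableM.
by apply/funext => y; case: (g y) (h y) => ? ? [].
Qed.

Lemma bounded_measurableC_cst c : bounded_measurableC (fun=> c).
Proof. by split. Qed.

Lemma bounded_measurableC_sum (I : Type) (s : seq I) (g : I -> 'rV[R]_d -> R[i]) :
  (forall i, bounded_measurableC (g i)) ->
  bounded_measurableC (fun y => \sum_(i <- s) g i y).
Proof.
move=> hg; split.
  under eq_fun do rewrite Re_sum.
  by apply: bounded_measurable_sum => i; exact: (hg i).1.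
under eq_fun do rewrite Im_sum.
by apply: bounded_measurable_sum => i; exact: (hg i).2.
Qed.

Lemma torus_intZ c g : bounded_measurableC g ->
  torus_int (fun y => c * g y) = c * torus_int g.
Proof.
case: c => a b [g1 g2]; rewrite /torus_int.
have -> : \int[lebesgue_rV R d]_(y in unit_cube (d := d)) complex.Re ((a +i* b) * g y) =
    \int[lebesgue_rV R d]_(y in unit_cube (d := d)) (a * complex.Re (g y) - b * complex.Im (g y)).
  by apply: eq_Rintegral => y _; case: (g y).
have -> : \int[lebesgue_rV R d]_(y in unit_cube (d := d)) complex.Im ((a +i* b) * g y) =
    \int[lebesgue_rV R d]_(y in unit_cube (d := d)) (a * complex.Im (g y) + b * complex.Re (g y)).
  by apply: eq_Rintegral => y _; case: (g y).
rewrite RintegralB ?RintegralD ?RintegralZl//; try exact: integrable_bm;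
  by apply: integrable_bm; exact: bounded_measurableM.
Qed.

Lemma torus_int_sum (I : Type) (s : seq I) (g : I -> 'rV[R]_d -> R[i]) :
  (forall i, bounded_measurableC (g i)) ->
  torus_int (fun y => \sum_(i <- s) g i y) = \sum_(i <- s) torus_int (g i).
Proof.
move=> hg; rewrite /torus_int; apply/eqP; rewrite eq_complex Re_sum Im_sum /=.
under eq_Rintegral do rewrite Re_sum.
under [X in _ && (X == _)]eq_Rintegral do rewrite Im_sum.
rewrite (Rintegral_sum mQ fQ) ?(Rintegral_sum mQ fQ) ?eqxx// => i.
  exact: (hg i).2.
exact: (hg i).1.
Qed.

Lemma dot_intD (m : 'rV[int]_d) (x y : 'rV[R]_d) :
  dot_int m (x + y) = dot_int m x + dot_int m y.
Proof.
by rewrite /dot_int -big_split; apply: eq_bigr => i _; rewrite mxE mulrDr.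
Qed.

Lemma dot_intMz (m : 'rV[int]_d) (x : 'rV[R]_d) (n : int) :
  dot_int m (x *~ n) = n%:~R * dot_int m x.
Proof.
rewrite /dot_int mulr_sumr; apply: eq_bigr => i _.
by rewrite -[x *~ n]scaler_int mxE mulrCA.
Qed.

Lemma dot_int0 (x : 'rV[R]_d) : dot_int 0 x = 0.
Proof. by rewrite /dot_int big1// => i _; rewrite mxE mul0r. Qed.

Lemma bounded_measurableC_e2pi (m : 'rV[int]_d) :
  bounded_measurableC (fun y => e2pi (- dot_int m y)).
Proof.
have mf : measurable_fun setT (fun y : 'rV[R]_d => 2 * pi * - dot_int m y).
  by apply: measurable_funM => //; apply: measurableT_comp => //; exact: measurable_dot_int.
split; split => /=.
- apply: (measurableT_comp _ mf).
  by apply: continuous_measurable_fun; exact: continuous_cos.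
- by exists 1 => y _; rewrite ler_norml cos_geN1 cos_le1.
- apply: (measurableT_comp _ mf).
  by apply: continuous_measurable_fun; exact: continuous_sin.
- by exists 1 => y _; rewrite ler_norml sin_geN1 sin_le1.
Qed.

Definition freq L (j l : {ffun 'I_d -> 'I_L}) : 'rV[int]_d :=
  \row_i ((j i)%:Z - (l i)%:Z).

(** A frequency [m] arises from [\prod_i (L - |m_i|)] pairs when every [|m_i| <= L], so these are
    the usual weights [\prod_i (1 - |m_i| / L)]. Keeping the pairs avoids computing
    multiplicities. *)
Definition fejer_mean L (f : 'rV[R]_d -> R[i]) (x : 'rV[R]_d) : R[i] :=
  (L%:R^-1 ^+ d) * \sum_(j : {ffun 'I_d -> 'I_L}) \sum_(l : {ffun 'I_d -> 'I_L})
     e2pi (dot_int (freq j l) x) * fourier_coef f (freq j l).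

Lemma fejer_e2pi L (t : R) : (fejer L t)%:C =
  L%:R^-1 * ((\sum_(j < L) e2pi (j%:R * t)) * (\sum_(j < L) e2pi (- (j%:R * t)))).
Proof.
have h1 : \sum_(j < L) e2pi (j%:R * t) =
    (\sum_(j < L) cos (2 * pi * (j%:R * t))) +i* (\sum_(j < L) sin (2 * pi * (j%:R * t))).
  by apply/eqP; rewrite eq_complex Re_sum Im_sum/= !eqxx.
have h2 : \sum_(j < L) e2pi (- (j%:R * t)) =
    (\sum_(j < L) cos (2 * pi * (j%:R * t))) +i* (- \sum_(j < L) sin (2 * pi * (j%:R * t))).
  apply/eqP; rewrite eq_complex Re_sum Im_sum/= -sumrN; apply/andP; split; apply/eqP.
    by apply: eq_bigr => j _; rewrite mulrN cosN.
  by apply: eq_bigr => j _; rewrite mulrN sinN.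
rewrite h1 h2 /fejer; set A := \sum_(j < L) cos _; set B := \sum_(j < L) sin _.
have -> : (A +i* B) * (A +i* - B) = (A ^+ 2 + B ^+ 2)%:C :> R[i].
  by apply/eqP; rewrite eq_complex/=; apply/andP; split; apply/eqP; ring.
by rewrite rmorphM fmorphV rmorph_nat.
Qed.

(** Distributing the product over coordinates of the one-dimensional sums produces one term per
    function from coordinates to indices, hence the sums over [{ffun 'I_d -> 'I_L}]. *)
Lemma fejer_rV_e2pi L (x y : 'rV[R]_d) : (fejer_rV L x y)%:C =
  (L%:R^-1 ^+ d) * \sum_(j : {ffun 'I_d -> 'I_L}) \sum_(l : {ffun 'I_d -> 'I_L})
     e2pi (dot_int (freq j l) x) * e2pi (- dot_int (freq j l) y).
Proof.
rewrite /fejer_rV rmorph_prod /=.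
under eq_bigr do rewrite fejer_e2pi.
rewrite big_split/= prodr_const card_ord; congr (_ * _).
rewrite big_split/= !bigA_distr_bigA/= mulr_suml; apply: eq_bigr => j _.
rewrite mulr_sumr; apply: eq_bigr => l _.
rewrite -!e2pi_sum -!e2piD; congr e2pi.
rewrite /dot_int -sumrN -!big_split/=; apply: eq_bigr => i _.
by rewrite mxE rmorphB/=; ring.
Qed.

Lemma torus_int_fejer L (f : 'rV[R]_d -> R[i]) (x : 'rV[R]_d) :
  bounded_measurableC f ->
  torus_int (fun y => f y * (fejer_rV L x y)%:C) = fejer_mean L f x.
Proof.
move=> hf.
pose g (j l : {ffun 'I_d -> 'I_L}) y := f y * e2pi (- dot_int (freq j l) y).
have hg j l : bounded_measurableC (g j l).
  by apply: bounded_measurableCM => //; exact: bounded_measurableC_e2pi.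
pose c (j l : {ffun 'I_d -> 'I_L}) := e2pi (dot_int (freq j l) x).
have hcg j l : bounded_measurableC (fun y => c j l * g j l y).
  by apply: bounded_measurableCM => //; exact: bounded_measurableC_cst.
have -> : (fun y => f y * (fejer_rV L x y)%:C) =
    (fun y => (L%:R^-1 ^+ d) * \sum_j \sum_l c j l * g j l y).
  apply/funext => y; rewrite fejer_rV_e2pi mulrCA; congr (_ * _).
  rewrite mulr_sumr; apply: eq_bigr => j _; rewrite mulr_sumr; apply: eq_bigr => l _.
  by rewrite /g mulrCA.
rewrite torus_intZ; last by do 2!apply: bounded_measurableC_sum => ?.
rewrite /fejer_mean; congr (_ * _).
rewrite torus_int_sum; last by move=> j; exact: bounded_measurableC_sum.
apply: eq_bigr => j _; rewrite torus_int_sum//; apply: eq_bigr => l _.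
by rewrite torus_intZ.
Qed.

(** [periodic_oscillation] and [fejer_rV_approx] are applied to the real and imaginary parts. Each
    part contributes [e/4] from continuity and at most [e/4] from the kernel once [L] is large. *)
Lemma fejer_mean_cvg (f : 'rV[R]_d -> R[i]) (x : 'rV[R]_d) (e : R) :
  continuous (f : 'rV[R]_d -> (R[i] : numFieldType)) -> periodic_Zd f -> 0 < e ->
  exists L0 : nat, forall L, (L0 <= L)%N -> normc (fejer_mean L.+1 f x - f x) <= e.
Proof.
move=> /continuous_Re_Im[c1 c2] pf e0.
have hf : bounded_measurableC f by split; exact: continuous_bounded_measurable.
have e4 : 0 < e / 4 by rewrite divr_gt0.
have [||C1 C10 hC1] := periodic_oscillation (u := fun x => complex.Re (f x)) x _ _ e4.
- exact: c1.
- by move=> y m; rewrite pf.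
have [||C2 C20 hC2] := periodic_oscillation (u := fun x => complex.Im (f x)) x _ _ e4.
- exact: c2.
- by move=> y m; rewrite pf.
pose C := Num.max C1 C2.
exists (Num.truncn (C * d%:R / (e / 4))) => L hL.
have CL C' : C' <= C -> C' * (d%:R / L.+1%:R) <= e / 4.
  move=> C'C; apply: (@le_trans _ _ (C * (d%:R / L.+1%:R))).
    by rewrite ler_wpM2r// divr_ge0.
  rewrite mulrA ler_pdivrMr// [leRHS]mulrC -ler_pdivrMr//.
  apply: ltW; apply: (lt_le_trans (truncnS_gt _)).
  by rewrite ler_nat ltnS.
have h1 := fejer_rV_approx (ltn0Sn L) hf.1 hC1.
have h2 := fejer_rV_approx (ltn0Sn L) hf.2 hC2.
apply: le_trans (ler_normc _) _.
rewrite -(torus_int_fejer L.+1 x hf) !raddfB /torus_int /=.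
have eqRe : \int[lebesgue_rV R d]_(y in unit_cube (d := d))
     complex.Re (f y * (fejer_rV L.+1 x y)%:C) =
   \int[lebesgue_rV R d]_(y in unit_cube (d := d)) (complex.Re (f y) * fejer_rV L.+1 x y).
  by apply: eq_Rintegral => y _; case: (f y) => a b /=; rewrite mulr0 subr0.
have eqIm : \int[lebesgue_rV R d]_(y in unit_cube (d := d))
     complex.Im (f y * (fejer_rV L.+1 x y)%:C) =
   \int[lebesgue_rV R d]_(y in unit_cube (d := d)) (complex.Im (f y) * fejer_rV L.+1 x y).
  by apply: eq_Rintegral => y _; case: (f y) => a b /=; rewrite mulr0 add0r.
rewrite eqRe eqIm.
have C1C : C1 <= C by rewrite le_max lexx.
have C2C : C2 <= C by rewrite le_max lexx orbT.
apply: le_trans (lerD h1 h2) _.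
apply: (@le_trans _ _ ((e / 4 + e / 4) + (e / 4 + e / 4))); last by lra.
by apply: lerD; apply: lerD => //; exact: CL.
Qed.

End torus_integral.

(** * Discrepancy of Fejer means *)

Section discrepancy.
Local Notation normc := ComplexField.Normc.normc.
Context {R : realType}.

(** The list is chosen before [g], so the same one serves the orbit sum of [f], the exponential sums
    and the total weight. *)
Lemma bounded_support_fsbig (w : int -> R[i]) : bounded_support w ->
  exists r : seq int, forall g : int -> R[i],
    \sum_(n \in [set: int]) w n * g n = \sum_(n <- r) w n * g n.
Proof.
move=> [M hM].
(* [Negz i] is [-(i + 1)], so [i < M] on the negative side reaches exactly [-M]. *)
pose r := undup ([seq Posz i | i <- iota 0 M.+1] ++ [seq Negz i | i <- iota 0 M]).
exists r => g; rewrite [RHS]fsbig_seq ?undup_uniq// -(fsbig_widen [set` r] setT)//.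
move=> n [_ /= nr]; rewrite hM ?mul0r// ltnNge; apply/negP => nM; apply: nr.
rewrite mem_undup mem_cat; case: n nM => k kM; apply/orP; [left|right];
  by apply: map_f; rewrite mem_iota.
Qed.

Variables (d : nat).

Lemma fourier_coef0 (f : 'rV[R]_d -> R[i]) : fourier_coef f 0 = torus_int f.
Proof.
rewrite /fourier_coef; congr torus_int; apply/funext => y.
by rewrite dot_int0 oppr0 e2pi0 mulr1.
Qed.

Lemma freq_inj L (j : {ffun 'I_d -> 'I_L}) : injective (freq j).
Proof.
move=> l l' /rowP h; apply/ffunP => i; apply/val_inj.
by have := h i; rewrite !mxE => /addrI /oppr_inj [].
Qed.

Lemma freqxx L (j : {ffun 'I_d -> 'I_L}) : freq j j = 0.
Proof. by apply/rowP => i; rewrite !mxE subrr. Qed.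

Variables (r : seq int) (w : int -> R[i]) (alpha : 'rV[R]_d) (f : 'rV[R]_d -> R[i]).
Hypothesis w1 : \sum_(n <- r) w n = 1.
Let ker (m : 'rV[int]_d) := \sum_(n <- r) w n * e2pi (n%:~R * dot_int m alpha).
Variable C : R.
Hypothesis hC : forall s : seq 'rV[int]_d, uniq s -> 0 \notin s ->
  \sum_(m <- s) normc (fourier_coef f m) * normc (ker m) <= C.

(** The diagonal pairs reproduce the integral of [f]. For fixed [j] the frequencies [j - l] with
    [l != j] are distinct and nonzero, so their terms sum to at most [C]; averaging over the [L ^ d]
    values of [j] preserves this bound. *)
Lemma fejer_mean_discrepancy L (x : 'rV[R]_d) : (0 < L)%N ->
  normc (\sum_(n <- r) w n * fejer_mean L f (x + alpha *~ n) - torus_int f) <= C.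
Proof.
move=> L0; pose F := {ffun 'I_d -> 'I_L}.
pose G (j l : F) := e2pi (dot_int (freq j l) x) * fourier_coef f (freq j l)
  * ker (freq j l).
have LR : (L%:R : R[i]) != 0 by rewrite pnatr_eq0 -lt0n.
have cF : #|{: F}| = (L ^ d)%N by rewrite card_ffun !card_ord.
have sumE : \sum_(n <- r) w n * fejer_mean L f (x + alpha *~ n) =
    (L%:R^-1 ^+ d) * \sum_j \sum_l G j l.
  rewrite /fejer_mean; under eq_bigr do rewrite mulrCA.
  rewrite -mulr_sumr; congr (_ * _).
  under eq_bigr do rewrite mulr_sumr; rewrite exchange_big; apply: eq_bigr => j _.
  under eq_bigr do rewrite mulr_sumr; rewrite exchange_big; apply: eq_bigr => l _ /=.
  rewrite /G /ker mulr_sumr; apply: eq_bigr => n _.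
  by rewrite dot_intD dot_intMz e2piD; ring.
have GE j : \sum_l G j l = torus_int f + \sum_(l | l != j) G j l.
  rewrite (bigD1 j)//=; congr (_ + _); rewrite /G /ker freqxx dot_int0 e2pi0 mul1r.
  rewrite fourier_coef0; under eq_bigr do rewrite dot_int0 mulr0 e2pi0 mulr1.
  by rewrite w1 mulr1.
have -> : \sum_(n <- r) w n * fejer_mean L f (x + alpha *~ n) - torus_int f =
    (L%:R^-1 ^+ d) * \sum_j \sum_(l | l != j) G j l.
  rewrite sumE; under eq_bigr do rewrite GE.
  rewrite big_split/= sumr_const cF mulrDr -[torus_int f *+ _]mulr_natl natrX mulrA.
  by rewrite -exprMn mulVf// expr1n mul1r addrC addKr.
rewrite ComplexField.Normc.normcM.
have -> : normc (L%:R^-1 ^+ d : R[i]) = (L%:R^-1 ^+ d : R).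
  have -> : (L%:R^-1 ^+ d : R[i]) = ((L%:R^-1 ^+ d : R))%:C.
    by rewrite rmorphXn/= fmorphV/= rmorph_nat.
  by rewrite /= expr0n/= addr0 sqrtr_sqr ger0_norm// exprn_ge0// invr_ge0.
rewrite exprVn ler_pdivrMl ?exprn_gt0 ?ltr0n//.
apply: le_trans (normc_sum _ _ _) _.
apply: (@le_trans _ _ (\sum_(j : F) C)); last first.
  by rewrite sumr_const cF -natrX mulr_natl.
apply: ler_sum => j _; apply: le_trans (normc_sum _ _ _) _.
pose s := [seq freq j l | l <- enum F & l != j].
have us : uniq s by rewrite (map_inj_uniq (@freq_inj L j)) filter_uniq ?enum_uniq.
have s0 : 0 \notin s.
  apply/mapP => -[l]; rewrite mem_filter => /andP[lj _].
  by rewrite -(freqxx j) => /freq_inj jl; rewrite jl eqxx in lj.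
apply: le_trans (hC us s0); rewrite /s big_map big_filter big_enum_cond/=.
apply: ler_sum => l _; rewrite /G !ComplexField.Normc.normcM.
by rewrite normc_e2pi mul1r.
Qed.

Hypothesis cf : continuous (f : 'rV[R]_d -> (R[i] : numFieldType)).
Hypothesis pf : periodic_Zd f.

(** The bound for Fejer means does not depend on [L], and [f] is sampled at finitely many points, so
    pointwise convergence suffices. *)
Lemma discrepancy_seq_le (x : 'rV[R]_d) :
  normc (\sum_(n <- r) w n * f (x + alpha *~ n) - torus_int f) <= C.
Proof.
apply/ler_addgt0Pr => e e0.
(* Replacing [f] by its mean within [e / W] at each sample point costs at most [e] in total; the
   added [1] keeps [W] positive. *)
pose W := \sum_(n <- r) normc (w n) + 1.
have W0 : 0 < W by rewrite ltr_wpDl// sumr_ge0// => n _; exact: normc_ge0.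
have eW : 0 < e / W by rewrite divr_gt0.
have [L hL] : exists L, forall n, n \in r ->
    normc (fejer_mean L.+1 f (x + alpha *~ n) - f (x + alpha *~ n)) <= e / W.
  have [L0 hL0] := choice (fun n => fejer_mean_cvg (x + alpha *~ n) cf pf eW).
  exists (\max_(n <- r) L0 n) => n nr; apply: hL0.
  by apply: leq_bigmax_seq.
have -> : \sum_(n <- r) w n * f (x + alpha *~ n) - torus_int f =
    (\sum_(n <- r) w n * fejer_mean L.+1 f (x + alpha *~ n) - torus_int f)
    - \sum_(n <- r) w n * (fejer_mean L.+1 f (x + alpha *~ n) - f (x + alpha *~ n)).
  under [X in _ = _ - X]eq_bigr do rewrite mulrBr.
  by rewrite sumrB; ring.
apply: le_trans (le_normcD _ _) _; rewrite normcN.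
apply: lerD; first exact: fejer_mean_discrepancy.
apply: le_trans (normc_sum _ _ _) _.
apply: (@le_trans _ _ (\sum_(n <- r) normc (w n) * (e / W))).
  rewrite big_seq [leRHS]big_seq; apply: ler_sum => n nr.
  by rewrite ComplexField.Normc.normcM ler_wpM2l ?hL//; exact: normc_ge0.
rewrite -mulr_suml mulrA ler_pdivrMr// mulrC ler_pM2l//.
by rewrite lerDl.
Qed.

End discrepancy.

(** * The discrepancy bound for almost every rotation vector *)

Theorem theorem1p1 (R : realType) (d : nat) (hd : (1 <= d)%N)
  (Phi : nat -> int -> R[i])
  (Phi_supp : forall N : nat, (1 <= N)%N -> bounded_support (Phi N))
  (Phi_sum : forall N : nat, (1 <= N)%N ->
    \sum_(n \in [set: int]) Phi N n = 1)
  (K theta : R) (hK : 0 < K) (htheta : 0 < theta)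
  (Phi_decay : forall (N : nat) (t : R), (1 <= N)%N ->
    ComplexField.Normc.normc
      (\sum_(n \in [set: int]) (Phi N n * e2pi (n%:~R * t)))
    <= K * (1 + N%:R * dist_int t) `^ (- theta))
  (delta : R)
  (delta_lt1 : theta < 1 -> d%:R / 2 < delta)
  (delta_ge1 : 1 <= theta -> d%:R * theta - d%:R / 2 < delta)
  (f : 'rV[R]_d -> R[i]) (hf : sobolev delta f) :
  {ae lebesgue_rV R d, forall alpha : 'rV[R]_d,
    exists2 c : R, 0 < c &
      forall N : nat, (1 <= N)%N ->
        (ereal_sup [set (ComplexField.Normc.normc
                           (discrepancy Phi N alpha f x))%:E
                   | x in [set: 'rV[R]_d]]
         <= (c * N%:R `^ (- theta))%:E)%E}.
Proof.
have [cf pf hnorm] := hf.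
have d0 : 0 < d%:R :> R by rewrite ltr0n.
have [q [q01 tq hq]] := ex_summability_exponent d0 htheta delta_lt1 delta_ge1.
have q02 : 0 < q < 2.
  by have /andP[-> q1] := q01; rewrite (le_lt_trans q1)// ltr1n.
have ba := bounded_sums_fourier hd q02 hq hnorm.
have := ae_small_divisors (fun m => normc_ge0 (fourier_coef f m)) q01 htheta tq ba.
apply: filterS => alpha [dpos [C hC]].
exists (K * (`|C| + 1)); first by rewrite mulr_gt0// ltr_wpDl.
move=> N N1; apply: ge_ereal_sup => _ [x _ <-]; rewrite lee_fin.
have [r hr] := bounded_support_fsbig (Phi_supp N N1).
have Nt0 : 0 <= K * N%:R `^ (- theta) by rewrite mulr_ge0 ?powR_ge0 ?(ltW hK).
rewrite /discrepancy (hr (fun n => f (x + alpha *~ n))).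
rewrite mulrAC; apply: (discrepancy_seq_le (alpha := alpha)) => //.
  rewrite -(Phi_sum N N1); have := hr (fun=> 1).
  by under eq_fsbigr do rewrite mulr1; under [in RHS]eq_bigr do rewrite mulr1.
move=> s us s0; apply: (@le_trans _ _ (K * N%:R `^ (- theta) * C)); last first.
  rewrite ler_wpM2l//; apply: le_trans (ler_norm C) _; by rewrite lerDl.
apply: le_trans (ler_wpM2l Nt0 (hC s us)); rewrite mulr_sumr.
rewrite big_seq [leRHS]big_seq; apply: ler_sum => m ms.
have m0 : m != 0 by apply: contra s0 => /eqP <-.
rewrite (negbTE m0) mulrCA.
(* A vanishing coefficient is set aside, since [||m.alpha||] may then be [0] and its negative power
   would take the default value [0]. *)
have [am|am] := eqVneq (ComplexField.Normc.normc (fourier_coef f m)) 0; first by rewrite am !mul0r.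
rewrite ler_wpM2l ?normc_ge0// -hr.
apply: le_trans (Phi_decay N (dot_int m alpha) N1) _.
rewrite -mulrA ler_wpM2l ?(ltW hK)// -powRM ?dist_int_ge0//.
have NR : 0 < N%:R :> R by rewrite ltr0n.
(* What remains is [N ||m.alpha|| <= 1 + N ||m.alpha||] under the exponent [- theta]; [dpos] ensures
   that the left side is positive. *)
apply: ler_powRN; first exact: ltW.
- by rewrite mulr_gt0 ?dpos.
- by rewrite lerDr.
Qed.
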